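(* Let $(\tilde{\mathbf{M}},\tilde{\nabla},\tilde{\nabla}^{*},\tilde{g})$ be an $(n+1)$-dimensional connected statistical manifold with constant curvature $\tilde{k}$, and let $(\mathbf{M},\nabla,\nabla^{*},g)$ be a connected statistical manifold of dimension $n\geq 3$. If there exists a statistical immersion $(f,\xi):(\mathbf{M},\nabla,\nabla^{*},g)\longrightarrow(\tilde{\mathbf{M}},\tilde{\nabla},\tilde{\nabla}^{*},\tilde{g})$ (that is, a statistical immersion $f$ with unit normal vector field $\xi$ along $f$) whose affine fundamental forms satisfy $h=h^{*}=g$, then $(\mathbf{M},\nabla,\nabla^{*},g)$ has constant curvature.
   Context: All objects are smooth and all affine connections are torsion-free. $\mathcal{X}(\mathbf{M})$ denotes the set of vector fields on $\mathbf{M}$. A statistical manifold $(\mathbf{M},\nabla,g)$ is a pseudo-Riemannian manifold $(\mathbf{M},g)$ with a torsion-free affine connection $\nabla$ such that $\nabla g$ is symmetric, i.e. $(\nabla_X g)(Y,Z)$ is symmetric in $X,Y,Z$. Its dual connection $\nabla^{*}$ is defined by $Xg(Y,Z)=g(\nabla_XY,Z)+g(Y,\nabla^{*}_XZ)$ for all vector fields $X,Y,Z$. One writes $(\mathbf{M},\nabla,\nabla^{*},g)$ to display the dual connection. The statistical manifold has constant curvature $k$ (with $k$ a constant) if the curvature tensor of $\nabla$ satisfies $R^{\nabla}(X,Y)Z=k\{g(Y,Z)X-g(X,Z)Y\}$. An immersion $f:(\mathbf{M},\nabla,g)\to(\tilde{\mathbf{M}},\tilde{\nabla},\tilde{g})$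 between statistical manifolds is a statistical immersion if $g=f^{*}\tilde{g}$ and $g(\nabla_XY,Z)=\tilde{g}(\tilde{\nabla}_Xf_*Y,f_*Z)$ for all $X,Y,Z\in\mathcal{X}(\mathbf{M})$. For an immersion $f$ of codimension one with unit normal vector field $\xi$ along $f$ (that is, $\tilde g(\xi,\xi)=1$ and $\tilde g(\xi,f_*X)=0$), one has $T_{f(p)}\tilde{\mathbf{M}}=f_*(T_p\mathbf{M})+\mathrm{span}\{\xi_p\}$. The affine fundamental forms $h,h^{*}$ are the symmetric bilinear forms on $\mathbf{M}$ defined by the Gauss formulae $\tilde{\nabla}_Xf_*Y=f_*(\nabla_XY)+h(X,Y)\xi$ and $\tilde{\nabla}^{*}_Xf_*Y=f_*(\nabla^{*}_XY)+h^{*}(X,Y)\xi$ for $X,Y\in\mathcal{X}(\mathbf{M})$. For a statistical immersion, the connections $\nabla,\nabla^{*}$ appearing here are the given connections on $\mathbf{M}$. *)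

(* Defs.v *)
From HB Require Import structures.
From mathcomp Require Import all_boot all_order all_algebra.
From mathcomp Require Import all_classical all_reals all_analysis.

Set Implicit Arguments.
Unset Strict Implicit.
Unset Printing Implicit Defensive.

Import Order.TTheory GRing.Theory Num.Theory.
Import numFieldNormedType.Exports.

Local Open Scope classical_set_scope.
Local Open Scope ring_scope.

(* Only meant for open [U]: differentiability and continuity at a point of [U]
   are those of [f] on the whole space, which then depend only on [f] in [U]. *)
Fixpoint Ck (R : realType) (n : nat) (W : normedModType R) (k : nat)
    (U : set 'rV[R]_n) (f : 'rV[R]_n -> W) : Prop :=
  if k is k'.+1 then
    (forall x, U x -> differentiable f x) /\ (forall v, Ck k' U ('D_v f))
  else forall x, U x -> {for x, continuous f}.

Definition smooth_on (R : realType) (n : nat) (W : normedModType R)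
    (U : set 'rV[R]_n) (f : 'rV[R]_n -> W) : Prop :=
  forall k, Ck k U f.

Record chart (R : realType) (n : nat) (T : topologicalType) := Chart {
  cdom : set T;
  cmap :> T -> 'rV[R]_n;
  cinv : 'rV[R]_n -> T;
  cdom_open : open cdom;
  cimg_open : open (cmap @` cdom);
  cmapK : forall p, cdom p -> cinv (cmap p) = p;
  cmap_cont : forall p, cdom p -> {for p, continuous cmap};
  cinv_cont : forall x, (cmap @` cdom) x -> {for x, continuous cinv} }.

(* [chart_at] selects, for each point, one chart of the atlas around it. It is
   used to identify the tangent space at [p] with R^n: the row vector [v]
   stands for the tangent vector whose components are [v] in the coordinate
   basis at [p] of the chart [chart_at p]. Hence a vector field is a function
   [M -> 'rV_n], whose values at different points may refer to different
   charts. *)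
Record manifold (R : realType) (n : nat) := Manifold {
  carrier :> topologicalType;
  atlas : set (chart R n carrier);
  chart_at : carrier -> chart R n carrier;
  chart_at_atlas : forall p, atlas (chart_at p);
  chart_at_dom : forall p, cdom (chart_at p) p;
  atlas_compat : forall phi psi : chart R n carrier, atlas phi -> atlas psi ->
    smooth_on (phi @` (cdom phi `&` cdom psi)) (psi \o cinv phi);
  manifold_hausdorff : hausdorff_space carrier;
  manifold_second_countable : @second_countable carrier }.

Section Geometry.
Context {R : realType}.

Definition smooth_fun n (M : manifold R n) (u : M -> R) : Prop :=
  forall phi, atlas phi -> smooth_on (phi @` cdom phi) (u \o cinv phi).

Definition smooth_map n m (M : manifold R n) (N : manifold R m)
    (F : M -> N) : Prop :=
  continuous F /\
  forall phi psi, atlas phi -> atlas psi ->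
    smooth_on (phi @` (cdom phi `&` F @^-1` cdom psi))
              (psi \o F \o cinv phi).

(* The tangent vector [v] at [p] applied to [u], a function defined on [M] and
   smooth near [p], with values in R or in R^m. *)
Definition tder n (M : manifold R n) (W : normedModType R)
    (p : M) (v : 'rV[R]_n) (u : M -> W) : W :=
  'D_v (u \o cinv (chart_at p)) (chart_at p p).

Definition tangent_map n m (M : manifold R n) (N : manifold R m)
    (F : M -> N) (p : M) (v : 'rV[R]_n) : 'rV[R]_m :=
  tder p v (cmap (chart_at (F p)) \o F).

Definition immersion n m (M : manifold R n) (N : manifold R m)
    (F : M -> N) : Prop :=
  smooth_map F /\ forall p, injective (tangent_map F p).

(* [V] is a smooth vector field along [F]; [V p] is a tangent vector of [N] at
   [F p]. *)
Definition vector_field_along n m (M : manifold R n) (N : manifold R m)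
    (F : M -> N) (V : M -> 'rV[R]_m) : Prop :=
  forall u : N -> R, smooth_fun u ->
    smooth_fun (fun p : M => tder (F p) (V p) u).

Definition vector_field n (M : manifold R n) (X : M -> 'rV[R]_n) : Prop :=
  vector_field_along (N := M) id X.

Definition push n m (M : manifold R n) (N : manifold R m) (F : M -> N)
    (X : M -> 'rV[R]_n) : M -> 'rV[R]_m :=
  fun p => tangent_map F p (X p).

(* [X, Y]^i = X (Y x^i) - Y (X x^i), for the coordinates x^i of [chart_at p] *)
Definition lie_bracket n (M : manifold R n) (X Y : M -> 'rV[R]_n) :
    M -> 'rV[R]_n :=
  fun p =>
    tder p (X p) (fun q => tder q (Y q) (cmap (chart_at p))) -
    tder p (Y p) (fun q => tder q (X q) (cmap (chart_at p))).

(* A connection on the vector bundle F^*TN over M. Operators on vector fields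
   are total functions; only their values on smooth fields are constrained. *)
Definition connection_along n m (M : manifold R n) (N : manifold R m)
    (F : M -> N)
    (D : (M -> 'rV[R]_n) -> (M -> 'rV[R]_m) -> M -> 'rV[R]_m) : Prop :=
  [/\ forall X V, vector_field X -> vector_field_along F V ->
        vector_field_along F (D X V),
      forall (a : M -> R) X Y V, smooth_fun a ->
        vector_field X -> vector_field Y -> vector_field_along F V ->
        forall p, D (fun q => a q *: X q + Y q) V p = a p *: D X V p + D Y V p,
      forall X V W, vector_field X ->
        vector_field_along F V -> vector_field_along F W ->
        forall p, D X (fun q => V q + W q) p = D X V p + D X W p
    & forall (a : M -> R) X V, smooth_fun a ->
        vector_field X -> vector_field_along F V ->
        forall p, D X (fun q => a q *: V q) p =
          tder p (X p) a *: V p + a p *: D X V p].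

Definition affine_connection n (M : manifold R n)
    (nabla : (M -> 'rV[R]_n) -> (M -> 'rV[R]_n) -> M -> 'rV[R]_n) : Prop :=
  connection_along (N := M) id nabla.

Definition torsion_free n (M : manifold R n)
    (nabla : (M -> 'rV[R]_n) -> (M -> 'rV[R]_n) -> M -> 'rV[R]_n) : Prop :=
  forall X Y, vector_field X -> vector_field Y ->
    forall p, nabla X Y p - nabla Y X p = lie_bracket X Y p.

Definition curvature n (M : manifold R n)
    (nabla : (M -> 'rV[R]_n) -> (M -> 'rV[R]_n) -> M -> 'rV[R]_n)
    (X Y Z : M -> 'rV[R]_n) : M -> 'rV[R]_n :=
  fun p => nabla X (nabla Y Z) p - nabla Y (nabla X Z) p
           - nabla (lie_bracket X Y) Z p.

(* [D] is the pull-back to F^*TN of the connection [nablaN] of N; for [X] on M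
   and [V] along [F], [D X V] is what is usually written nablaN_X V. *)
Definition pullback_connection n m (M : manifold R n) (N : manifold R m)
    (F : M -> N)
    (nablaN : (N -> 'rV[R]_m) -> (N -> 'rV[R]_m) -> N -> 'rV[R]_m)
    (D : (M -> 'rV[R]_n) -> (M -> 'rV[R]_m) -> M -> 'rV[R]_m) : Prop :=
  connection_along F D /\
  forall X W Z, vector_field X -> vector_field W -> vector_field Z ->
    forall p, W (F p) = tangent_map F p (X p) ->
      D X (Z \o F) p = nablaN W Z (F p).

Definition symmetric_tensor n (M : manifold R n)
    (g : M -> 'rV[R]_n -> 'rV[R]_n -> R) : Prop :=
  [/\ forall p u v, g p u v = g p v u,
      forall p a u v w, g p (a *: u + v) w = a * g p u w + g p v w
    & forall X Y, vector_field X -> vector_field Y ->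
        smooth_fun (fun p => g p (X p) (Y p))].

Definition pseudo_riemannian n (M : manifold R n)
    (g : M -> 'rV[R]_n -> 'rV[R]_n -> R) : Prop :=
  symmetric_tensor g /\
  forall p u, (forall v, g p u v = 0) -> u = 0.

(* (nabla_X g)(Y, Z) *)
Definition nabla_metric n (M : manifold R n)
    (nabla : (M -> 'rV[R]_n) -> (M -> 'rV[R]_n) -> M -> 'rV[R]_n)
    (g : M -> 'rV[R]_n -> 'rV[R]_n -> R)
    (X Y Z : M -> 'rV[R]_n) (p : M) : R :=
  tder p (X p) (fun q => g q (Y q) (Z q))
  - g p (nabla X Y p) (Z p) - g p (Y p) (nabla X Z p).

Definition statistical_manifold n (M : manifold R n)
    (nabla : (M -> 'rV[R]_n) -> (M -> 'rV[R]_n) -> M -> 'rV[R]_n)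
    (g : M -> 'rV[R]_n -> 'rV[R]_n -> R) : Prop :=
  [/\ pseudo_riemannian g, affine_connection nabla, torsion_free nabla
    & forall X Y Z, vector_field X -> vector_field Y -> vector_field Z ->
        forall p,
          nabla_metric nabla g X Y Z p = nabla_metric nabla g Y X Z p /\
          nabla_metric nabla g X Y Z p = nabla_metric nabla g X Z Y p].

Definition dual_connection n (M : manifold R n)
    (g : M -> 'rV[R]_n -> 'rV[R]_n -> R)
    (nabla nablas : (M -> 'rV[R]_n) -> (M -> 'rV[R]_n) -> M -> 'rV[R]_n) :
    Prop :=
  affine_connection nablas /\
  forall X Y Z, vector_field X -> vector_field Y -> vector_field Z ->
    forall p, tder p (X p) (fun q => g q (Y q) (Z q)) =
      g p (nabla X Y p) (Z p) + g p (Y p) (nablas X Z p).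

Definition constant_curvature n (M : manifold R n)
    (nabla : (M -> 'rV[R]_n) -> (M -> 'rV[R]_n) -> M -> 'rV[R]_n)
    (g : M -> 'rV[R]_n -> 'rV[R]_n -> R) (k : R) : Prop :=
  forall X Y Z, vector_field X -> vector_field Y -> vector_field Z ->
    forall p, curvature nabla X Y Z p =
      k *: (g p (Y p) (Z p) *: X p - g p (X p) (Z p) *: Y p).

(* In the next two definitions [D] is the pull-back along [f] of the connection
   of the target. *)
Definition statistical_immersion n m (M : manifold R n) (N : manifold R m)
    (nabla : (M -> 'rV[R]_n) -> (M -> 'rV[R]_n) -> M -> 'rV[R]_n)
    (g : M -> 'rV[R]_n -> 'rV[R]_n -> R)
    (gN : N -> 'rV[R]_m -> 'rV[R]_m -> R)
    (f : M -> N)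
    (D : (M -> 'rV[R]_n) -> (M -> 'rV[R]_m) -> M -> 'rV[R]_m) : Prop :=
  [/\ immersion f,
      forall p u v,
        g p u v = gN (f p) (tangent_map f p u) (tangent_map f p v)
    & forall X Y Z, vector_field X -> vector_field Y -> vector_field Z ->
        forall p, g p (nabla X Y p) (Z p) =
          gN (f p) (D X (push f Y) p) (push f Z p)].

Definition affine_fundamental_form n m (M : manifold R n) (N : manifold R m)
    (nabla : (M -> 'rV[R]_n) -> (M -> 'rV[R]_n) -> M -> 'rV[R]_n)
    (f : M -> N) (xi : M -> 'rV[R]_m)
    (D : (M -> 'rV[R]_n) -> (M -> 'rV[R]_m) -> M -> 'rV[R]_m)
    (h : M -> 'rV[R]_n -> 'rV[R]_n -> R) : Prop :=
  symmetric_tensor h /\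
  forall X Y, vector_field X -> vector_field Y ->
    forall p, D X (push f Y) p =
      push f (nabla X Y) p + h p (X p) (Y p) *: xi p.

Definition unit_normal_field n m (M : manifold R n) (N : manifold R m)
    (gN : N -> 'rV[R]_m -> 'rV[R]_m -> R)
    (f : M -> N) (xi : M -> 'rV[R]_m) : Prop :=
  [/\ vector_field_along f xi,
      forall p, gN (f p) (xi p) (xi p) = 1
    & forall p v, gN (f p) (xi p) (tangent_map f p v) = 0].

End Geometry.

(* Main.v *)
Require Import Defs.
From mathcomp Require Import all_boot all_order all_algebra.
From mathcomp Require Import all_classical all_reals all_analysis.
From mathcomp Require Import ring lra.

(** The Gauss equation carries the theorem. Write [D] for the pull-back of the
    connection of [N]. Differentiating the Gauss formula
    D_Y f_*Z = f_*(nabla_Y Z) + g(Y, Z) xi once more and antisymmetrizing, the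
    tangential part of the curvature of [D] on f_*Z is
    R(X, Y)Z + g(Y, Z) S X - g(X, Z) S Y, where S X is the tangential part of
    D_X xi ([gauss_curvature]). The shape operator S is governed by the dual
    connection: differentiating gN(xi, f_*W) = 0 with the duality of [D] and
    [Ds] gives gN(D_X xi, f_*W) = - h*(X, W) ([weingarten]), so that S X = - X
    when h* = g. The curvature of [D] itself is that of [N], which is
    kN (g(Y, Z) X - g(X, Z) Y) on tangent vectors ([pullback_curvature]).
    Comparing, R(X, Y)Z = (kN + 1)(g(Y, Z) X - g(X, Z) Y).

    The work lies in passing from vector fields on [N], which are what the
    curvature and the duality of [N] speak about, to the fields f_*Z and xi
    along [f], which need not extend to [N]. Near a point every field along [f]
    is a combination of fields E_j o f with smooth coefficients, for global
    fields E_j on [N] that are a frame near the image point ([exists_frame],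
    [field_in_frame]). Both the curvature of [D] and the defect in the duality
    of [D] and [Ds] are local and linear over smooth functions in the field
    along [f], so it suffices to know them on the E_j o f.

    Locality and the extension of local objects to global ones rest on smooth
    cutoff functions ([exists_cutoff]), built from exp(-1/t). Linearity of the
    curvature over functions is the identity [X, Y]u = X(Yu) - Y(Xu)
    ([lie_bracketE]); for a bracket defined by the components X(Y x^i) - Y(X x^i)
    it expresses the symmetry of second derivatives ([derive_sym]). *)

Set Implicit Arguments.
Unset Strict Implicit.
Unset Printing Implicit Defensive.

Import Order.TTheory GRing.Theory Num.Theory.
Import numFieldNormedType.Exports.

Local Open Scope classical_set_scope.
Local Open Scope ring_scope.

(** * Calculus of C^k functions on R^n *)

Section local_differentiability.
Context {R : realType} {V W : normedModType R}.

(** The vanishing of [e] near [x] gives, with differential 0, the first-order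
    expansion that characterizes differentiability. *)
Lemma near0_differentiable (e : V -> W) x :
  (\near x, e x = 0) -> differentiable e x.
Proof.
move=> e0.
have eo : e \o shift x = cst (e x) + (\0 : V -> W) +o_ 0 id.
  apply: eqaddoE; rewrite (nbhs_singleton e0).
  rewrite -[cst 0]/(0 : V -> W) -[\0]/(0 : V -> W) !add0r.
  apply/eqoP => _/posnumP[eps]; near=> h.
  rewrite /= (_ : e (h + x) = 0) ?normr0 ?mulr_ge0//.
  near: h; have := e0; rewrite (near_shift 0 x).
  by apply: filterS => h /=; rewrite subr0.
have c0 : continuous (\0 : V -> W) by exact: cst_continuous.
by apply/diff_locallyP; rewrite (diff_unique c0 eo).
Unshelve. all: by end_near. Qed.

Lemma near_eq_differentiable (f g : V -> W) x :
  (\near x, f x = g x) -> differentiable f x -> differentiable g x.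
Proof.
move=> fg df; have -> : g = f + (g - f) by rewrite addrC subrK.
apply: differentiableD => //; apply: near0_differentiable.
by near=> y; rewrite /= !fctE (near fg y)// subrr.
Unshelve. all: by end_near. Qed.

End local_differentiability.

Section Ck_calculus.
Context {R : realType}.
Implicit Types (n m k : nat).

Lemma derive_coord n m (F : 'rV[R]_n -> 'rV[R]_m) x v i :
  derivable F x v -> 'D_v F x 0 i = 'D_v (fun y => F y 0 i) x.
Proof. by move=> dF; rewrite derive_mx// mxE. Qed.

Lemma derive_chain (U V W : normedModType R) (G : U -> V) (F : V -> W) x v :
  differentiable G x -> differentiable F (G x) ->
  'D_v (F \o G) x = 'D_('D_v G x) F (G x).
Proof.
move=> dG dF; have dFG := differentiable_comp dG dF.
by rewrite (deriveE _ dFG) (deriveE _ dF) (deriveE _ dG) diff_comp.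
Qed.

Lemma derive_row n (W : normedModType R) (F : 'rV[R]_n -> W) x v :
  differentiable F x ->
  'D_v F x = \sum_i v 0 i *: 'D_(delta_mx 0 i) F x.
Proof.
move=> dF; rewrite deriveE// {1}(row_sum_delta v) linear_sum.
by apply: eq_bigr => i _; rewrite linearZ deriveE.
Qed.

Lemma Ck_sub n (W : normedModType R) k (U V : set 'rV[R]_n) (F : 'rV[R]_n -> W) :
  V `<=` U -> Ck k U F -> Ck k V F.
Proof.
move=> VU; elim: k F => [|k IH] F /=; first by move=> cF x /VU/cF.
by case=> dF cF; split=> [x /VU/dF//|v]; exact/IH/cF.
Qed.

(** [Ck] is a pointwise condition, so it can be checked on any cover; the
    members need not be open. *)
Lemma Ck_cover n (W : normedModType R) k (U : set 'rV[R]_n) (F : 'rV[R]_n -> W) :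
  (forall x, U x -> exists2 V : set 'rV[R]_n, V x & Ck k V F) -> Ck k U F.
Proof.
elim: k F => [|k IH] F cF /=.
  by move=> x /cF[V Vx]; exact.
split=> [x /cF[V Vx [dF _]]|v]; first exact: dF.
by apply: IH => x /cF[V Vx [_ /(_ v) dF]]; exists V.
Qed.

(** Openness matters: [Ck] at a point depends on the germ of the function
    there. *)
Lemma Ck_ext n (W : normedModType R) k (U : set 'rV[R]_n) (F G : 'rV[R]_n -> W) :
  open U -> (forall x, U x -> F x = G x) -> Ck k U F -> Ck k U G.
Proof.
move=> oU; elim: k F G => [|k IH] F G FG /=.
  move=> cF x Ux; have FGx : \near x, F x = G x.
    by apply: filterS (open_nbhs_nbhs (conj oU Ux)).
  have := cF x Ux; rewrite /prop_for /continuous_at FG//.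
  by apply: cvg_trans; exact: (near_eq_cvg FGx).
have FGn x : U x -> \near x, F x = G x.
  by move=> Ux; apply: filterS (open_nbhs_nbhs (conj oU Ux)).
case=> dF cF; split=> [x Ux|v].
  exact: near_eq_differentiable (FGn x Ux) (dF x Ux).
by apply: IH (cF v) => x Ux; exact/near_eq_derive/FGn.
Qed.

Lemma Ck_pred n (W : normedModType R) k (U : set 'rV[R]_n) (F : 'rV[R]_n -> W) :
  Ck k.+1 U F -> Ck k U F.
Proof.
elim: k F => [|k IH] F [dF cF].
  by move=> x Ux; exact/differentiable_continuous/dF.
by split=> // v; exact/IH/cF.
Qed.

Lemma Ck_cst n (W : normedModType R) k (U : set 'rV[R]_n) (c : W) :
  Ck k U (cst c).
Proof.
elim: k c => [|k IH] c; first by move=> x _; exact: cst_continuous.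
split=> [x _|v]; first exact: differentiable_cst.
by rewrite (_ : 'D_v _ = cst 0)//; apply/funext => x; rewrite derive_cst.
Qed.

Lemma CkD n k (U : set 'rV[R]_n) (F G : 'rV[R]_n -> R) :
  open U -> Ck k U F -> Ck k U G -> Ck k U (F + G).
Proof.
move=> oU; elim: k F G => [|k IH] F G.
  by move=> cF cG x Ux; apply: continuousD; [exact: cF|exact: cG].
move=> [dF cF] [dG cG]; split=> [x Ux|v].
  by apply: differentiableD; [exact: dF|exact: dG].
apply: (Ck_ext oU _ (IH _ _ (cF v) (cG v))) => x Ux.
by rewrite deriveD//; apply: diff_derivable; [exact: dF|exact: dG].
Qed.

Lemma CkM n k (U : set 'rV[R]_n) (F G : 'rV[R]_n -> R) :
  open U -> Ck k U F -> Ck k U G -> Ck k U (F * G).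
Proof.
move=> oU; elim: k F G => [|k IH] F G.
  by move=> cF cG x Ux; apply: continuousM; [exact: cF|exact: cG].
move=> CF CG; move: (CF) (CG) => [dF cF] [dG cG]; split=> [x Ux|v].
  by apply: differentiableM; [exact: dF|exact: dG].
have C1 := CkD oU (IH _ _ (Ck_pred CF) (cG v)) (IH _ _ (Ck_pred CG) (cF v)).
apply: (Ck_ext oU _ C1) => x Ux.
by rewrite deriveM//; apply: diff_derivable; [exact: dF|exact: dG].
Qed.

Lemma Ck_sum n k (I : finType) (U : set 'rV[R]_n) (F : I -> 'rV[R]_n -> R) :
  open U -> (forall i, Ck k U (F i)) -> Ck k U (fun x => \sum_i F i x).
Proof.
move=> oU cF; rewrite (_ : (fun _ => _) = \sum_i F i); last first.
  by apply/funext => x; rewrite fct_sumE.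
by elim/big_ind: _ => [|G H|i _]; [exact: Ck_cst|exact: CkD|exact: cF].
Qed.

Lemma Ck_coord n m k (U : set 'rV[R]_n) (F : 'rV[R]_n -> 'rV[R]_m) i :
  open U -> Ck k U F -> Ck k U (fun x => F x 0 i).
Proof.
move=> oU; elim: k F => [|k IH] F.
  move=> cF x Ux; have := @coord_continuous R _ _ 0 i (F x).
  exact: (continuous_comp (cF x Ux)).
move=> [dF cF]; split=> [x Ux|v].
  exact: (differentiable_comp (dF x Ux) (differentiable_coord _ 0 i)).
apply: (Ck_ext oU _ (IH _ (cF v))) => x Ux.
by rewrite derive_coord//; apply: diff_derivable; exact: dF.
Qed.

Lemma Ck_id n k (U : set 'rV[R]_n) : Ck k U (@id 'rV[R]_n).
Proof.
case: k => [x _|k]; first exact: cvg_id.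
split=> [x _|v]; first by [].
rewrite (_ : 'D_v _ = cst v); first exact: Ck_cst.
by apply/funext => x; rewrite derive_id.
Qed.

(** By the chain rule, the derivative of [F \o G] along [v] is the sum of the
    products of the components of the derivative of [G] with the partial
    derivatives of [F] composed with [G]; these have the form treated one order
    below. *)
Lemma Ck_comp n m k (U : set 'rV[R]_n) (V : set 'rV[R]_m)
    (G : 'rV[R]_n -> 'rV[R]_m) (F : 'rV[R]_m -> R) :
  open U -> (forall x, U x -> V (G x)) ->
  Ck k U G -> Ck k V F -> Ck k U (F \o G).
Proof.
move=> oU GV; elim: k F => [|k IH] F CG CF.
  by move=> x Ux; apply: continuous_comp; [exact: CG|exact/CF/GV].
move: (CG) (CF) => [dG cG] [dF cF]; split=> [x Ux|v].
  by apply: differentiable_comp; [exact: dG|exact/dF/GV].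
have C1 : Ck k U (fun x => \sum_i
    ((fun y => 'D_v G y 0 i) * ('D_(delta_mx 0 i) F \o G)) x).
  apply: Ck_sum => // i; apply: CkM => //; first exact: Ck_coord (cG v).
  exact: IH (Ck_pred CG) (cF _).
apply: (Ck_ext oU _ C1) => x Ux.
rewrite derive_chain; [|exact: dG|exact/dF/GV].
by rewrite derive_row//; exact/dF/GV.
Qed.

End Ck_calculus.

(** * Smooth bump functions *)

Section flat_functions.
Context {R : realType}.

(** The functions t^-m exp(-1/t), extended by 0 to t <= 0. All exponents are
    needed at once because the derivative raises them: the linear span of the
    family is stable under differentiation. *)
Definition flat (m : nat) (t : R) : R :=
  if 0 < t then t^-1 ^+ m * expR (- t^-1) else 0.

(** A quadratic bound makes both the value and the derivative at 0 vanish; it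
    holds because exp(1/t) dominates the single Taylor term t^-(m+2) / (m+2)!.
    *)
Lemma flat_bound m t : `|flat m t| <= m.+2`!%:R * t ^+ 2.
Proof.
rewrite /flat; case: ifPn => [t0|_]; last first.
  by rewrite normr0 mulr_ge0// sqr_ge0.
rewrite ger0_norm; last by rewrite mulr_ge0 ?expR_ge0// exprn_ge0// invr_ge0 ltW.
have s0 : 0 < t^-1 by rewrite invr_gt0.
have := @expR_ge1Dxn _ (t^-1) m.+1 (ltW s0).
rewrite -[in leRHS](opprK t^-1) (expRN (- t^-1)).
set e := expR (- t^-1) => H.
have e0 : 0 < e by exact: expR_gt0.
have H1 : t^-1 ^+ m.+2 / m.+2`!%:R <= e^-1 by apply: le_trans H; rewrite lerDr.
have f0 : 0 < m.+2`!%:R :> R by rewrite ltr0n fact_gt0.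
rewrite ler_pdivrMr// in H1.
have H2 : e * t^-1 ^+ m.+2 <= m.+2`!%:R.
  by rewrite mulrC -ler_pdivlMr// mulrC.
have -> : t^-1 ^+ m * e = e * t^-1 ^+ m.+2 * t ^+ 2.
  have st : t^-1 ^+ 2 * t ^+ 2 = 1 by rewrite -exprMn mulVf ?expr1n ?lt0r_neq0.
  by rewrite -(addn2 m) exprD -2!mulrA st mulr1 mulrC.
by rewrite ler_wpM2r// sqr_ge0.
Qed.

Lemma is_derive_flat m (t : R) :
  is_derive t (1 : R) (flat m) (flat m.+2 t - m%:R * flat m.+1 t).
Proof.
have [t0|t0|->] := ltrgt0P t.
- have tn0 : t != 0 by exact: lt0r_neq0.
  have nf : \near t, t^-1 ^+ m * expR (- t^-1) = flat m t.
    by near=> s; rewrite /flat ifT//; near: s; exact: lt_nbhsr.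
  apply: near_eq_is_derive nf _.
  have dV : is_derive t (1 : R) (fun s : R => s^-1) (- t ^- 2 *: 1).
    exact: (@is_deriveV _ id).
  have dE : is_derive t (1 : R) (expR \o (fun s : R => - s^-1))
      (expR (- t^-1) * - (- t ^- 2 *: 1)).
    exact: is_derive1_comp.
  rewrite (_ : (fun _ => _) =
      (fun s : R => s^-1) ^+ m * (expR \o (fun s : R => - s^-1))); last first.
    by apply/funext => s; rewrite /= exprfctE.
  apply: (is_derive_eq (is_deriveM (is_deriveX m dV) dE)).
  rewrite /flat t0 /= -!(exprVn t) exprfctE -![_ *: _]/(_ * _).
  case: m => [|m] /=; first by rewrite !expr0; ring.
  by rewrite !exprS; ring.
- have nf : \near t, cst 0 t = flat m t.
    near=> s; rewrite /flat ifF//; apply/negbTE; rewrite -leNgt ltW//.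
    by near: s; exact: lt_nbhsl.
  have -> : flat m.+2 t - m%:R * flat m.+1 t = 0.
    by rewrite /flat ltNge (ltW t0)/= mulr0 subr0.
  exact: near_eq_is_derive nf _.
have f0 k : flat k 0 = 0 by rewrite /flat ltxx.
rewrite !f0 mulr0 subr0.
have C : (fun h : R => h^-1 *: (flat m (h *: 1 + 0) - flat m 0)) @ 0^' --> (0 : R).
  apply/cvgr0Pnorm_le => _/posnumP[e].
  have M0 : 0 < m.+2`!%:R :> R by rewrite ltr0n fact_gt0.
  near=> h; have h0 : h != 0 by near: h; exact: nbhs_dnbhs_neq.
  rewrite f0 subr0 addr0 -[h *: 1]/(h * 1) mulr1 normrZ normfV.
  rewrite ler_pdivrMl ?normr_gt0//; apply: le_trans (flat_bound m h) _.
  rewrite -[h ^+ 2]ger0_norm ?sqr_ge0// normrX mulrC expr2 -mulrA.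
  rewrite ler_wpM2l// -ler_pdivlMr//.
  near: h; apply: dnbhs0_le; exact: divr_gt0.
split; first by apply/cvg_ex; exists 0.
exact: cvg_lim C.
Unshelve. all: by end_near.
Qed.

End flat_functions.

Section bump.
Context {R : realType} {n : nat}.
Implicit Types (U : set 'rV[R]_n) (q : 'rV[R]_n -> R).

Lemma derive_comp_scalar (phi : R -> R) q x v (d : R) :
  differentiable q x -> is_derive (q x) (1 : R) phi d ->
  'D_v (phi \o q) x = 'D_v q x * d.
Proof.
move=> dq [dphi <-]; have dphi' := (derivable1_diffP _ _).1 dphi.
rewrite derive_chain// !(deriveE _ dphi') -[in LHS](mulr1 ('D_v q x)).
by rewrite -[_ * 1]/(_ *: 1) linearZ.
Qed.

(** The induction runs over all exponents simultaneously, since the derivative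
    of [flat m \o q] involves the exponents m+1 and m+2. *)
Lemma Ck_flat k m U q : open U -> Ck k U q -> Ck k U (flat m \o q).
Proof.
have dflat j t : differentiable (flat j : R -> R) t.
  by apply/derivable1_diffP; case: (is_derive_flat j t).
move=> oU; elim: k m => [|k IH] m cq.
  move=> x Ux; apply: continuous_comp; first exact: cq.
  exact/differentiable_continuous/dflat.
move: (cq) => [dq cDq]; split=> [x Ux|v].
  by apply: differentiable_comp; [exact: dq|exact: dflat].
have C1 : Ck k U ('D_v q * ((flat m.+2 \o q) +
    (cst (- m%:R) * (flat m.+1 \o q)))).
  apply: CkM => //; first exact: cDq.
  apply: CkD => //; first exact/IH/Ck_pred.
  by apply: CkM => //; [exact: Ck_cst|exact/IH/Ck_pred].
apply: (Ck_ext oU _ C1) => x Ux.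
rewrite (derive_comp_scalar v (dq x Ux) (is_derive_flat m (q x))).
by rewrite !fctE mulNr.
Qed.

(** A smooth function equal to 1 for t <= 0 and to 0 for t >= 1. Nesting [flat
    0] twice avoids a quotient of smooth functions: for t >= 1 the inner
    difference is nonpositive, and for t <= 0 it is the constant exp(-1). *)
Definition plateau (t : R) : R :=
  flat 0 (expR (-1) - flat 0 t) / flat 0 (expR (-1)).

Lemma plateau1 t : t <= 0 -> plateau t = 1.
Proof.
move=> t0; rewrite /plateau {2}/flat ltNge t0/= subr0 divff//.
by rewrite /flat expR_gt0 expr0 mul1r gt_eqF// expR_gt0.
Qed.

Lemma plateau0 t : 1 <= t -> plateau t = 0.
Proof.
move=> t1; have t0 : 0 < t by exact: lt_le_trans t1.
rewrite /plateau {1}/flat ifF ?mul0r//; apply/negbTE; rewrite -leNgt subr_le0.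
by rewrite /flat t0 expr0 mul1r ler_expR lerN2 invf_le1.
Qed.

Lemma Ck_plateau k U q : open U -> Ck k U q -> Ck k U (plateau \o q).
Proof.
move=> oU cq; rewrite (_ : plateau \o q =
  (flat 0 \o (cst (expR (-1)) + cst (-1) * (flat 0 \o q))) *
  cst (flat 0 (expR (-1)))^-1); last first.
  by apply/funext => x; rewrite /plateau/= !fctE/= mulN1r.
apply: CkM => //; last exact: Ck_cst.
apply: Ck_flat => //; apply: CkD => //; first exact: Ck_cst.
by apply: CkM => //; [exact: Ck_cst|exact: Ck_flat].
Qed.

(** The plateau is applied to 2 |x - c|^2 / r^2 - 1 with the Euclidean norm,
    which is smooth; the support condition is in the sup norm of row vectors,
    which is at most the Euclidean one. *)
Lemma exists_bump (c : 'rV[R]_n) (r : R) : 0 < r ->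
  exists b : 'rV[R]_n -> R, [/\ smooth_on setT b, \near c, b c = 1 &
    forall x, r <= `|x - c| -> b x = 0].
Proof.
move=> r0; have r20 : 0 < r ^+ 2 / 2 by rewrite divr_gt0// exprn_gt0.
pose q (x : 'rV[R]_n) := \sum_i (x 0 i - c 0 i) ^+ 2.
have cq k : Ck k setT q.
  apply: Ck_sum => [|i]; first exact: openT.
  rewrite (_ : (fun _ => _) = ((fun x : 'rV[R]_n => x 0 i) + cst (- c 0 i)) *
    ((fun x : 'rV[R]_n => x 0 i) + cst (- c 0 i))); last first.
    by apply/funext => x; rewrite /= expr2.
  have C1 : Ck k setT ((fun x : 'rV[R]_n => x 0 i) + cst (- c 0 i)).
    apply: CkD; [exact: openT| |exact: Ck_cst].
    by apply: Ck_coord; [exact: openT|exact: Ck_id].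
  by apply: CkM => //; exact: openT.
exists (plateau \o (q * cst (2 / r ^+ 2) + cst (-1))); split.
- move=> k; apply: Ck_plateau; first exact: openT.
  apply: CkD; [exact: openT| |exact: Ck_cst].
  by apply: CkM; [exact: openT|exact: cq|exact: Ck_cst].
- have qc : q c = 0 by rewrite /q big1// => i _; rewrite subrr expr0n.
  have : \forall x \near c, q x < r ^+ 2 / 2.
    have := cq 0%N c I; rewrite /prop_for /continuous_at qc => /(_ [set y | y < r ^+ 2 / 2]).
    by apply; exact: lt_nbhsl.
  apply: filterS => x qx; apply: plateau1.
  rewrite !fctE subr_le0 mulrA ler_pdivrMr ?exprn_gt0// mul1r.
  by rewrite -ler_pdivlMr// ltW.
- move=> x rx; apply: plateau0; rewrite !fctE lerBrDr mulrA.
  rewrite ler_pdivlMr ?exprn_gt0// -(ler_pM2l (ltr0n _ 2)).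
  move: rx; rewrite [leRHS]/Num.Def.normr/= mx_normrE => /bigmax_geP[|[[i j] _]].
    by rewrite leNgt r0.
  rewrite /= !ord1 !mxE => rj.
  have : r ^+ 2 <= q x.
    rewrite /q (bigD1 j)//=; apply: (@le_trans _ _ ((x 0 j - c 0 j) ^+ 2)).
      by rewrite -(real_normK (num_real (x 0 j - _))) lerXn2r ?nnegrE// ltW.
    by rewrite lerDl sumr_ge0// => l _; exact: sqr_ge0.
  lra.
Qed.

End bump.

(** * Symmetry of second derivatives *)

Section symmetry_of_second_derivatives.
Context {R : realType} {V : normedModType R}.

Lemma is_derive_line (F : V -> R) (x v : V) (r : R) :
  differentiable F (x + r *: v) ->
  is_derive r (1 : R) (fun t => F (x + t *: v)) ('D_v F (x + r *: v)).
Proof.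
move=> dF.
have dG : is_diff r (fun t : R => x + t *: v) (0 + *:%R^~ v).
  exact: (@is_diffD _ _ _ (cst x) _ 0).
have dL : 'D_1 (fun t : R => x + t *: v) r = v.
  by rewrite (deriveE _ ex_diff) diff_val !fctE/= scale1r add0r.
have dFG : differentiable (F \o (fun t : R => x + t *: v)) r.
  exact: differentiable_comp.
split; first exact: diff_derivable.
by rewrite -[fun t => _]/(F \o (fun t : R => x + t *: v)) derive_chain// dL.
Qed.

Lemma MVT_line (F : V -> R) (x v : V) (s : R) : 0 < s ->
  (forall r, 0 <= r <= s -> differentiable F (x + r *: v)) ->
  exists2 r, 0 <= r <= s & F (x + s *: v) - F x = s * 'D_v F (x + r *: v).
Proof.
move=> s0 dF.
have [||r] := @MVT _ (fun t => F (x + t *: v))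
    (fun r => 'D_v F (x + r *: v)) 0 s s0.
- move=> r /[!in_itv]/= /andP[r0 rs]; apply: is_derive_line; apply: dF.
  by rewrite !ltW.
- apply: derivable_within_continuous => r /[!in_itv]/= /dF/is_derive_line.
  by case.
move=> /[!in_itv]/= /andP[r0 rs]; rewrite subr0 scale0r addr0 => ->.
by exists r; rewrite ?ltW// mulrC.
Qed.

(** Two applications of the mean value theorem: to the increment of [F] by s w
    along the segment in direction v, then to the derivative of [F] along v on
    the segment in direction w. *)
Lemma second_difference (F : V -> R) (x v w : V) (s : R) : 0 < s ->
  (forall r t, 0 <= r <= s -> 0 <= t <= s ->
    differentiable F (x + r *: v + t *: w) /\
    differentiable ('D_v F) (x + r *: v + t *: w)) ->
  exists r t, [/\ 0 <= r <= s, 0 <= t <= s &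
    F (x + s *: v + s *: w) - F (x + s *: v) - (F (x + s *: w) - F x) =
    s ^+ 2 * 'D_w ('D_v F) (x + r *: v + t *: w)].
Proof.
move=> s0 dF; have ss : 0 <= s <= s by rewrite lexx ltW.
have s00 : 0 <= (0 : R) <= s by rewrite lexx ltW.
pose G := (F \o shift (s *: w)) - F.
have dshift (y a : V) : is_diff y (shift a) (id + 0).
  rewrite (_ : shift a = id + cst a) //.
  exact: (@is_diffD _ _ _ id (cst a) id 0).
have dFr r t : 0 <= r <= s -> 0 <= t <= s ->
    differentiable (F \o shift (t *: w)) (x + r *: v).
  move=> rs ts; apply: differentiable_comp => //.
  by case: (dF r t rs ts).
have dF0 r : 0 <= r <= s -> differentiable F (x + r *: v).
  by move=> rs; have [+ _] := dF r 0 rs s00; rewrite scale0r addr0.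
have [r rs dG] : exists2 r, 0 <= r <= s &
    G (x + s *: v) - G x = s * 'D_v G (x + r *: v).
  apply: MVT_line => // r rs; apply: differentiableB; first exact: dFr.
  exact: dF0.
have [t ts dD] := MVT_line s0 (fun t ts => (dF r t rs ts).2).
exists r, t; split=> //.
rewrite expr2 -mulrA -dD -[X in _ - X](_ : G x = _)//.
rewrite -[X in X - _](_ : G (x + s *: v) = _)// dG; congr (_ * _).
rewrite deriveB; last 2 first.
- exact/diff_derivable/dFr.
- exact/diff_derivable/dF0.
congr (_ - _); rewrite derive_chain//; last by case: (dF r s rs ss).
by congr ('D_ _ F _); rewrite deriveE// diff_val/= addr0.
Qed.

(** The second difference of [F] is symmetric in [v] and [w], and divided by
    s^2 it is a value of either second derivative at a point within O(s) of
    [x]; continuity concludes. *)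
Lemma derive_sym (F : V -> R) (x v w : V) :
  (\near x, [/\ differentiable F x, differentiable ('D_v F) x &
    differentiable ('D_w F) x]) ->
  {for x, continuous ('D_w ('D_v F))} -> {for x, continuous ('D_v ('D_w F))} ->
  'D_w ('D_v F) x = 'D_v ('D_w F) x.
Proof.
move=> dF cvw cwv; apply/eqP; rewrite -subr_eq0 -normr_le0.
apply/ler_addgt0Pl => _/posnumP[e]; rewrite addr0.
have e2 : 0 < e%:num / 2 by exact: divr_gt0.
move/cvgrPdist_lt : cvw => /(_ _ e2) N1.
move/cvgrPdist_lt : cwv => /(_ _ e2) N2.
have /nbhs_ballP[d /= d0 dP] : \forall y \near x, [/\ differentiable F y,
    differentiable ('D_v F) y & differentiable ('D_w F) y] /\
    (`|'D_w ('D_v F) x - 'D_w ('D_v F) y| < e%:num / 2 /\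
     `|'D_v ('D_w F) x - 'D_v ('D_w F) y| < e%:num / 2).
  exact: (filterI dF (filterI N1 N2)).
(* s is so small that x + r v + t w stays in the ball for r, t <= s; the
   summand 1 keeps the denominator positive when v = w = 0 *)
pose s := d / (`|v| + `|w| + 1).
have m0 : 0 < `|v| + `|w| + 1 by rewrite ltr_wpDl// addr_ge0.
have s0 : 0 < s by exact: divr_gt0.
have inb r t : 0 <= r <= s -> 0 <= t <= s -> ball x d (x + r *: v + t *: w).
  move=> /andP[r0 rs] /andP[t0 ts]; rewrite -ball_normE/= -addrA opprD addNKr normrN.
  apply: le_lt_trans (ler_normD _ _) _; rewrite !normrZ !ger0_norm//.
  apply: (@le_lt_trans _ _ (s * `|v| + s * `|w|)).
    by rewrite lerD// ler_wpM2r.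
  by rewrite -mulrDr /s mulrAC -mulrA gtr_pMr// ltr_pdivrMr// mul1r ltrDl.
clearbody s.
have [|r [t [rs ts E1]]] := @second_difference F x v w s s0.
  by move=> r t rs ts; have [[]] := dP _ (inb r t rs ts).
have [|t' [r' [ts' rs' E2]]] := @second_difference F x w v s s0.
  move=> t1 r1 t1s r1s; rewrite addrAC.
  by have [[]] := dP _ (inb r1 t1 r1s t1s).
have E : 'D_w ('D_v F) (x + r *: v + t *: w) =
         'D_v ('D_w F) (x + t' *: w + r' *: v).
  have s2 : s ^+ 2 != 0 by rewrite expf_neq0// lt0r_neq0.
  have P1 : F (x + s *: v + s *: w) = F (x + s *: w + s *: v).
    by congr F; exact: addrAC.
  apply: (mulfI s2 (etrans (esym E1) (etrans _ E2))); rewrite P1.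
  by move: (F _) (F _) (F _) (F _) => a b c d'; ring.
have tri (a b c : R) : `|a - c| < e%:num / 2 -> `|b - c| < e%:num / 2 ->
    `|a - b| <= e%:num.
  rewrite (distrC b) => ac cb; rewrite [leRHS]splitr -(subrKA c).
  by apply: le_trans (ler_normD _ _) _; apply: lerD; exact: ltW.
have [_ [_ H2]] := dP _ (inb r' t' rs' ts').
rewrite (addrAC x) in H2.
have [_ [H1 _]] := dP _ (inb r t rs ts).
rewrite E in H1; exact: tri H1 H2.
Qed.

End symmetry_of_second_derivatives.

(** * Germs of smooth functions and charts *)

Lemma near_open_nbhs (T : topologicalType) (x : T) (P : set T) :
  (\near x, P x) -> exists2 V, open_nbhs x V & V `<=` P.
Proof. by rewrite /prop_near1 nbhsE. Qed.

Section smooth_germs.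
Context {R : realType}.
Implicit Types (n m : nat).

(** Smoothness of a germ: a neighbourhood common to all orders of
    differentiability, so that the predicate is stable under derivation and is
    itself an open condition. *)
Definition smooth_at n (W : normedModType R) (x : 'rV[R]_n)
    (F : 'rV[R]_n -> W) : Prop :=
  exists2 U, open_nbhs x U & smooth_on U F.

Lemma smooth_on_at n (W : normedModType R) (U : set 'rV[R]_n)
    (F : 'rV[R]_n -> W) x :
  smooth_on U F -> nbhs x U -> smooth_at x F.
Proof.
move=> cF; rewrite nbhsE => -[V oV VU]; exists V => // k.
exact: Ck_sub VU (cF k).
Qed.

(** Although the neighbourhoods vary with the point, they form a cover. *)
Lemma smooth_at_on n (W : normedModType R) (U : set 'rV[R]_n)
    (F : 'rV[R]_n -> W) :
  (forall x, U x -> smooth_at x F) -> smooth_on U F.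
Proof.
by move=> cF k; apply: Ck_cover => x /cF[V [_ Vx] cV]; exists V.
Qed.

Section vector_valued.
Context {n : nat} {W : normedModType R}.
Implicit Types (F G : 'rV[R]_n -> W) (x : 'rV[R]_n).

Lemma near_smooth_at x F : smooth_at x F -> \near x, smooth_at x F.
Proof.
case=> U [oU Ux] cF; near=> y; exists U => //; split=> //.
by near: y; exact: open_nbhs_nbhs.
Unshelve. all: by end_near. Qed.

Lemma smooth_at_ext x F G :
  (\near x, F x = G x) -> smooth_at x F -> smooth_at x G.
Proof.
case/near_open_nbhs=> V [oV Vx] FG [U [oU Ux] cF].
have oUV : open (U `&` V) by exact: openI.
exists (U `&` V) => // k; apply: (Ck_ext oUV (F := F)).
  by move=> y [_ /FG].
by apply: Ck_sub (cF k) => y [].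
Qed.

Lemma smooth_at_differentiable x F : smooth_at x F -> differentiable F x.
Proof. by case=> U [_ Ux] /(_ 1%N)[+ _]; apply. Qed.

Lemma smooth_at_continuous x F : smooth_at x F -> {for x, continuous F}.
Proof. by case=> U [_ Ux] /(_ 0%N); apply. Qed.

Lemma smooth_at_derive x F v : smooth_at x F -> smooth_at x ('D_v F).
Proof. by case=> U oU cF; exists U => // k; have [_ /(_ v)] := cF k.+1. Qed.

Lemma smooth_at_cst x (a : W) : smooth_at x (cst a).
Proof. by exists setT; [split=> //; exact: openT|move=> k; exact: Ck_cst]. Qed.

End vector_valued.

Section scalar_valued.
Context {n : nat}.
Implicit Types (F G : 'rV[R]_n -> R) (x : 'rV[R]_n).

Lemma smooth_atD x F G : smooth_at x F -> smooth_at x G -> smooth_at x (F + G).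
Proof.
move=> [U [oU Ux] cF] [V [oV Vx] cG].
have oUV : open (U `&` V) by exact: openI.
exists (U `&` V) => // k; apply: CkD => //.
  by apply: Ck_sub (cF k) => y [].
by apply: Ck_sub (cG k) => y [].
Qed.

Lemma smooth_atM x F G : smooth_at x F -> smooth_at x G -> smooth_at x (F * G).
Proof.
move=> [U [oU Ux] cF] [V [oV Vx] cG].
have oUV : open (U `&` V) by exact: openI.
exists (U `&` V) => // k; apply: CkM => //.
  by apply: Ck_sub (cF k) => y [].
by apply: Ck_sub (cG k) => y [].
Qed.

End scalar_valued.

Lemma smooth_at_coord n m x (F : 'rV[R]_n -> 'rV[R]_m) i :
  smooth_at x F -> smooth_at x (fun y => F y 0 i).
Proof.
by case=> U [oU Ux] cF; exists U => // k; exact: Ck_coord.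
Qed.

Lemma smooth_at_comp n m x (G : 'rV[R]_n -> 'rV[R]_m) (F : 'rV[R]_m -> R) :
  smooth_at x G -> smooth_at (G x) F -> smooth_at x (F \o G).
Proof.
move=> sG [V oV cF]; have GV : \near x, V (G x).
  by apply: (smooth_at_continuous sG); exact: open_nbhs_nbhs.
case: sG => U oU cG.
have [T oT TUV] : exists2 T, open_nbhs x T & T `<=` U `&` (V \o G).
  by apply: near_open_nbhs; apply: filterI => //; exact: open_nbhs_nbhs.
exists T => // k; apply: (Ck_comp (V := V)) (cF k); first by case: oT.
  by move=> y /TUV[].
by apply: Ck_sub (cG k) => y /TUV[].
Qed.

End smooth_germs.

Section charts.
Context {R : realType} {n : nat} {T : topologicalType} (phi : chart R n T).

Lemma near_cdom p : cdom phi p -> \near p, cdom phi p.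
Proof. by move=> pp; apply: open_nbhs_nbhs; split=> //; exact: cdom_open. Qed.

Lemma cimg_nbhs p : cdom phi p -> nbhs (phi p) (phi @` cdom phi).
Proof.
by move=> pp; apply: open_nbhs_nbhs; split; [exact: cimg_open|exists p].
Qed.

Lemma near_cinv p (P : set T) : cdom phi p -> (\near p, P p) ->
  \forall x \near phi p, P (cinv phi x).
Proof.
move=> pp nP; have ip : (phi @` cdom phi) (phi p) by exists p.
by apply: (cinv_cont ip); rewrite cmapK.
Qed.

Lemma near_cmap p (P : set 'rV[R]_n) : cdom phi p -> (\forall x \near phi p, P x) ->
  \forall q \near p, P (phi q).
Proof. by move=> pp nP; exact: (cmap_cont pp). Qed.

Lemma near_cinvK p : cdom phi p ->
  \forall x \near phi p, cdom phi (cinv phi x) /\ phi (cinv phi x) = x.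
Proof.
by move=> pp; apply: filterS (cimg_nbhs pp) => _ [q pq <-]; rewrite cmapK.
Qed.

End charts.

(** * Smooth functions and tangent vectors on a manifold *)

Section smooth_functions.
Context {R : realType} {n : nat} {M : manifold R n}.
Implicit Types (p q : M) (u w : M -> R).

(** Smoothness of the germ of [u] at [p], read in the chart that also carries
    the tangent space at [p]. *)
Definition smooth_near p u : Prop :=
  smooth_at (chart_at p p) (u \o cinv (chart_at p)).

Lemma smooth_transition (phi psi : chart R n M) p :
  atlas phi -> atlas psi -> cdom phi p -> cdom psi p ->
  smooth_at (phi p) (psi \o cinv phi).
Proof.
move=> aphi apsi pp qp; apply: smooth_on_at (atlas_compat aphi apsi) _.
apply: filterS (filterI (near_cinvK pp) (near_cinv pp (near_cdom qp))).
by move=> x [[dx xE] dx']; exists (cinv phi x).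
Qed.

Lemma near_chart_change (W : normedModType R) (phi psi : chart R n M)
    (u : M -> W) p : cdom phi p -> cdom psi p ->
  \forall x \near psi p,
    ((u \o cinv phi) \o (phi \o cinv psi)) x = (u \o cinv psi) x.
Proof.
move=> pp qp; apply: filterS (near_cinv qp (near_cdom pp)) => x dx /=.
by rewrite cmapK.
Qed.

(** Near the point the two local expressions differ by composition with a
    transition map. *)
Lemma smooth_at_chart_change (phi psi : chart R n M) p u :
  atlas phi -> atlas psi -> cdom phi p -> cdom psi p ->
  smooth_at (phi p) (u \o cinv phi) -> smooth_at (psi p) (u \o cinv psi).
Proof.
move=> aphi apsi pp qp su; apply: smooth_at_ext (near_chart_change u pp qp) _.
apply: smooth_at_comp; first exact: smooth_transition.
by rewrite /= cmapK.
Qed.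

Lemma smooth_nearP (phi : chart R n M) p u : atlas phi -> cdom phi p ->
  smooth_near p u <-> smooth_at (phi p) (u \o cinv phi).
Proof.
move=> aphi pp; have ac := chart_at_atlas p; have cp := chart_at_dom p.
by split; exact: smooth_at_chart_change.
Qed.

Lemma smooth_funP u : smooth_fun u <-> forall p, smooth_near p u.
Proof.
split=> su => [p|phi aphi].
  apply: smooth_on_at (su _ (chart_at_atlas p)) _.
  exact/cimg_nbhs/chart_at_dom.
by apply: smooth_at_on => _ [p pp <-]; exact/smooth_nearP.
Qed.

Lemma near_smooth_near p u : smooth_near p u -> \near p, smooth_near p u.
Proof.
move=> /near_smooth_at/(near_cmap (chart_at_dom p)) su.
near=> q; apply/(smooth_nearP _ (chart_at_atlas p)).
  by near: q; exact/near_cdom/chart_at_dom.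
by near: q.
Unshelve. all: by end_near. Qed.

Lemma smooth_near_ext p u w : (\near p, u p = w p) ->
  smooth_near p u -> smooth_near p w.
Proof.
by move=> uw; apply: smooth_at_ext; exact: near_cinv (chart_at_dom p) uw.
Qed.

Lemma smooth_near_cst p (a : R) : smooth_near p (cst a).
Proof. exact: smooth_at_cst. Qed.

Lemma smooth_nearD p u w : smooth_near p u -> smooth_near p w ->
  smooth_near p (fun q => u q + w q).
Proof. exact: smooth_atD. Qed.

Lemma smooth_nearM p u w : smooth_near p u -> smooth_near p w ->
  smooth_near p (fun q => u q * w q).
Proof. exact: smooth_atM. Qed.

Lemma smooth_near_chart (phi : chart R n M) p i : atlas phi -> cdom phi p ->
  smooth_near p (fun q => phi q 0 i).
Proof.
move=> aphi pp; apply/(smooth_nearP _ aphi pp).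
exact: smooth_at_coord (smooth_transition aphi aphi pp pp).
Qed.

Lemma smooth_near_pullback (phi : chart R n M) p (F : 'rV[R]_n -> R) :
  atlas phi -> cdom phi p -> smooth_at (phi p) F -> smooth_near p (F \o phi).
Proof.
move=> aphi pp sF; apply/(smooth_nearP _ aphi pp).
apply: smooth_at_ext sF; apply: filterS (near_cinvK pp) => x [_ /= xE].
by rewrite /= xE.
Qed.

End smooth_functions.

Section tangent_vectors.
Context {R : realType} {n : nat} {M : manifold R n}.
Implicit Types (p q : M) (u w : M -> R) (v : 'rV[R]_n).

Lemma tder_ext (W : normedModType R) p v (u w : M -> W) :
  (\near p, u p = w p) -> tder p v u = tder p v w.
Proof.
by move=> uw; apply: near_eq_derive; exact: near_cinv (chart_at_dom p) uw.
Qed.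

Lemma tder_cst p v (a : R) : tder p v (cst a) = 0.
Proof. exact: derive_cst. Qed.

Lemma tderD p v u w : smooth_near p u -> smooth_near p w ->
  tder p v (fun q => u q + w q) = tder p v u + tder p v w.
Proof.
move=> /smooth_at_differentiable du /smooth_at_differentiable dw.
exact: (deriveD (diff_derivable du) (diff_derivable dw)).
Qed.

Lemma tderM p v u w : smooth_near p u -> smooth_near p w ->
  tder p v (fun q => u q * w q) = tder p v u * w p + u p * tder p v w.
Proof.
move=> /smooth_at_differentiable du /smooth_at_differentiable dw.
rewrite /tder [LHS](deriveM (diff_derivable du) (diff_derivable dw)) /=.
rewrite cmapK; last exact: chart_at_dom.
by rewrite addrC; congr (_ + _); exact: mulrC.
Qed.

Lemma tder_lin p (a : R) v v' u : smooth_near p u ->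
  tder p (a *: v + v') u = a * tder p v u + tder p v' u.
Proof.
by move=> /smooth_at_differentiable du; rewrite /tder !deriveE// linearP.
Qed.

Lemma tder0v p (W : normedModType R) (u : M -> W) : tder p 0 u = 0.
Proof. exact: derive0. Qed.

Lemma tderZ p (a : R) v u : smooth_near p u ->
  tder p (a *: v) u = a * tder p v u.
Proof. by move=> su; have := tder_lin a v 0 su; rewrite tder0v !addr0. Qed.

Lemma tderDv p v v' u : smooth_near p u ->
  tder p (v + v') u = tder p v u + tder p v' u.
Proof. by move=> su; have := tder_lin 1 v v' su; rewrite scale1r mul1r. Qed.

Lemma tder_sumv p (I : finType) (v : I -> 'rV[R]_n) u : smooth_near p u ->
  tder p (\sum_i v i) u = \sum_i tder p (v i) u.
Proof.
move=> su; elim/big_rec2: _ => [|i a b _ <-]; first exact: tder0v.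
exact: tderDv.
Qed.

(** The components of [v] in the chart [phi] are [tder p v phi], whatever chart
    serves to represent the tangent space at [p]. *)
Lemma tder_chart (phi : chart R n M) p v u :
  atlas phi -> cdom phi p -> smooth_near p u ->
  tder p v u = 'D_(tder p v phi) (u \o cinv phi) (phi p).
Proof.
move=> aphi pp su; have ac := chart_at_atlas p; have cp := chart_at_dom p.
have st := smooth_transition ac aphi cp pp.
have du := smooth_at_differentiable ((smooth_nearP _ aphi pp).1 su).
rewrite /tder -(near_eq_derive _ (near_chart_change u pp cp)) derive_chain.
- by rewrite /= cmapK.
- exact: smooth_at_differentiable.
- by rewrite /= cmapK.
Qed.

Lemma tder_coord p v i : tder p v (fun q => chart_at p q 0 i) = v 0 i.
Proof.
have cp := chart_at_dom p; rewrite /tder.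
rewrite (near_eq_derive (g := fun x : 'rV[R]_n => x 0 i)); last first.
  by apply: filterS (near_cinvK cp) => x [_ /= ->].
by rewrite -(derive_coord (F := id))// derive_id.
Qed.

(** The coordinate functions of the chart at [p] recover the components of a
    tangent vector. *)
Lemma tder_sep p v v' :
  (forall u, smooth_near p u -> tder p v u = tder p v' u) -> v = v'.
Proof.
move=> vv'; apply/rowP => i; rewrite -!(tder_coord p _ i); apply: vv'.
exact: smooth_near_chart (chart_at_atlas p) (chart_at_dom p).
Qed.

Lemma tder_coords (phi : chart R n M) p v i :
  atlas phi -> cdom phi p -> tder p v phi 0 i = tder p v (fun q => phi q 0 i).
Proof.
move=> aphi pp; rewrite /tder derive_coord//.
apply/diff_derivable/smooth_at_differentiable.
exact: smooth_transition (chart_at_atlas p) _ (chart_at_dom p) _.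
Qed.

End tangent_vectors.

(** * Cutoff functions *)

Section cutoffs.
Context {R : realType} {n : nat} {M : manifold R n}.
Implicit Types (p q : M) (u w : M -> R).

(** A bump in the chart at [p] is extended by 0. The extension is smooth at
    points outside the domain of the chart because the support is compact,
    hence closed in a Hausdorff space, and such points have a neighbourhood on
    which the function vanishes. *)
Lemma exists_cutoff p (O : set M) : (\near p, O p) ->
  exists b : M -> R, exists K : set M,
    [/\ smooth_fun b, \near p, b p = 1, closed K, K `<=` O &
        forall q, ~ K q -> b q = 0].
Proof.
move=> nO; pose c := chart_at p; have cp : cdom c p := chart_at_dom p.
have ac : atlas c := chart_at_atlas p.
have /nbhs_ballP[r /= r0 rO] : \forall x \near c p,
    (cdom c (cinv c x) /\ c (cinv c x) = x) /\ O (cinv c x).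
  exact: filterI (near_cinvK cp) (near_cinv cp nO).
have r20 : 0 < r / 2 by exact: divr_gt0.
have [beta [sbeta beta1 beta0]] := exists_bump (c p) r20.
pose K0 := [set x : 'rV[R]_n | `|x - c p| <= r / 2].
have K0r x : K0 x -> ball (c p) r x.
  rewrite -ball_normE /K0 /= distrC => /le_lt_trans; apply.
  by rewrite ltr_pdivrMr// mulr_natr mulr2n ltrDl.
have cK0 : compact K0.
  apply: bounded_closed_compact.
    exists (r / 2 + `|c p|); split; first exact: num_real.
    move=> x rx y; rewrite /K0 /= => yr; apply: ltW; apply: le_lt_trans rx.
    rewrite -[y in leLHS](subrK (c p)); apply: le_trans (ler_normD _ _) _.
    by rewrite lerD2r.
  rewrite (_ : K0 = closed_ball (c p) (r / 2)); first exact: closed_ball_closed.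
  by rewrite closed_ballE//; apply/funext => x; rewrite /K0 /closed_ball_ /= distrC.
have dK0 x : K0 x -> cdom c (cinv c x) /\ c (cinv c x) = x.
  by move=> /K0r/rO[].
have clK : closed (cinv c @` K0).
  apply: compact_closed; first exact: manifold_hausdorff.
  apply: continuous_compact => //; apply: continuous_in_subspaceT => x.
  rewrite inE => /dK0[dx cx]; apply: cinv_cont; by exists (cinv c x).
(* the test on the domain matters: away from it the values of c are arbitrary *)
pose b q := if `[< cdom c q >] then beta (c q) else 0.
have b0 q : ~ (cinv c @` K0) q -> b q = 0.
  move=> nK; rewrite /b; case: asboolP => // dq; apply: beta0; rewrite leNgt.
  apply/negP => /ltW qr; apply: nK; exists (c q) => //; exact: cmapK.
exists b, (cinv c @` K0); split=> //.
- apply/smooth_funP => q; have [dq|ndq] := pselect (cdom c q).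
    have sb : smooth_near q (beta \o c).
      apply: smooth_near_pullback => //; apply: smooth_on_at sbeta _.
      exact: filterT.
    apply: smooth_near_ext sb; apply: filterS (near_cdom dq) => s ds.
    by rewrite /b asboolT.
  apply: smooth_near_ext (smooth_near_cst q 0).
  have nKq : (~` (cinv c @` K0)) q by move=> [x /dK0[dx _] xq]; rewrite -xq in ndq.
  have : nbhs q (~` (cinv c @` K0)).
    by apply: open_nbhs_nbhs; split=> //; exact: closed_openC.
  by apply: filterS => s nKs; rewrite b0.
- apply: filterS (filterI (near_cdom cp) (near_cmap cp beta1)) => q [dq bq].
  by rewrite /b asboolT.
- by move=> _ [x /K0r/rO[_ Ox] <-].
Qed.

Lemma smooth_fun_cutoff (b u : M -> R) (K : set M) :
  smooth_fun b -> closed K -> (forall q, ~ K q -> b q = 0) ->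
  (forall q, K q -> smooth_near q u) -> smooth_fun (fun q => b q * u q).
Proof.
move=> /smooth_funP sb cK b0 su; apply/smooth_funP => q.
have [Kq|nKq] := pselect (K q); first exact: smooth_nearM (sb q) (su q Kq).
apply: smooth_near_ext (smooth_near_cst q 0).
have : nbhs q (~` K).
  by apply: open_nbhs_nbhs; split=> //; exact: closed_openC.
by apply: filterS => s nKs; rewrite b0// mul0r.
Qed.

(** Vector fields and tensors are tested on globally defined functions only;
    this lemma lets them act on germs. *)
Lemma smooth_extension p u : smooth_near p u ->
  exists2 w, smooth_fun w & \near p, u p = w p.
Proof.
move=> /near_smooth_near/exists_cutoff[b [K [sb b1 cK Ku b0]]].
exists (fun q => b q * u q); first exact: smooth_fun_cutoff sb cK b0 Ku.
by apply: filterS b1 => q bq; rewrite bq mul1r.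
Qed.

End cutoffs.

(** * Smooth maps and fields along them *)

Section fields_and_maps.
Context {R : realType}.

Lemma smooth_map_continuous n m (M : manifold R n) (N : manifold R m)
    (F : M -> N) (p : M) (P : set N) : smooth_map F ->
  (\forall q \near F p, P q) -> \near p, P (F p).
Proof. by move=> [cF _] nP; exact: (cF p). Qed.

Lemma smooth_map_id n (M : manifold R n) : smooth_map (@id M).
Proof.
split=> [p|phi psi aphi apsi]; first exact: cvg_id.
exact: atlas_compat.
Qed.

Section along.
Context {n m : nat} {M : manifold R n} {N : manifold R m} {F : M -> N}.
Hypothesis sF : smooth_map F.
Implicit Types (p q : M) (u : N -> R).

Lemma smooth_map_charts (phi : chart R n M) (psi : chart R m N) p :
  atlas phi -> atlas psi -> cdom phi p -> cdom psi (F p) ->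
  smooth_at (phi p) (psi \o F \o cinv phi).
Proof.
move=> aphi apsi pp qp; apply: smooth_on_at (sF.2 _ _ aphi apsi) _.
have nF : \near p, (F @^-1` cdom psi) p.
  exact: smooth_map_continuous sF (near_cdom qp).
apply: filterS (filterI (near_cinvK pp) (near_cinv pp nF)).
by move=> x [[dx xE] dx']; exists (cinv phi x).
Qed.

Lemma near_map_charts (W : normedModType R) (c : chart R n M)
    (d : chart R m N) p (u : N -> W) : cdom c p -> cdom d (F p) ->
  \forall x \near c p,
    ((u \o cinv d) \o (d \o F \o cinv c)) x = ((u \o F) \o cinv c) x.
Proof.
move=> cp dp; have nF : \near p, (F @^-1` cdom d) p.
  exact: smooth_map_continuous sF (near_cdom dp).
by apply: filterS (near_cinv cp nF) => x dx /=; rewrite cmapK.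
Qed.

Lemma smooth_near_comp p u : smooth_near (F p) u -> smooth_near p (u \o F).
Proof.
move=> su; have cp := chart_at_dom p; have dp := chart_at_dom (F p).
apply: smooth_at_ext (near_map_charts u cp dp) _.
apply: smooth_at_comp.
  exact: smooth_map_charts (chart_at_atlas _) (chart_at_atlas _) cp dp.
by rewrite /= cmapK.
Qed.

Lemma tder_comp p v u : smooth_near (F p) u ->
  tder p v (u \o F) = tder (F p) (tangent_map F p v) u.
Proof.
move=> su; have cp := chart_at_dom p; have dp := chart_at_dom (F p).
have sm := smooth_map_charts (chart_at_atlas _) (chart_at_atlas _) cp dp.
rewrite /tder -(near_eq_derive _ (near_map_charts u cp dp)) derive_chain.
- by rewrite /= cmapK.
- exact: smooth_at_differentiable sm.
- by rewrite /= cmapK//; exact: smooth_at_differentiable su.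
Qed.

(** A field along [F] applied to a germ at [F p] is smooth near [p]: replace
    the germ by a global function with the same values near [F p]. *)
Lemma field_smooth_near (V : M -> 'rV[R]_m) p u : vector_field_along F V ->
  smooth_near (F p) u -> smooth_near p (fun q => tder (F q) (V q) u).
Proof.
move=> sV /smooth_extension[w sw uw].
have sw' := (smooth_funP _).1 (sV w sw) p.
apply: smooth_near_ext sw'.
have uw' : \near p, (\forall y \near F p, u y = w y).
  exact: (smooth_map_continuous
    (P := fun y => \forall z \near y, u z = w z) sF (near_join uw)).
by apply: filterS uw' => q uwq; apply/esym/tder_ext.
Qed.

End along.
End fields_and_maps.

Section fields_along_maps.
Context {R : realType} {n m : nat} {M : manifold R n} {N : manifold R m}.
Context {F : M -> N}.
Hypothesis sF : smooth_map F.
Implicit Types (V W : M -> 'rV[R]_m).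

(** f_*X applied to u is X applied to u o F. *)
Lemma push_field X : vector_field X -> vector_field_along F (push F X).
Proof.
move=> sX u /smooth_funP su.
rewrite (_ : (fun _ => _) = fun p => tder p (X p) (u \o F)); last first.
  by apply/funext => p; rewrite tder_comp.
by apply: sX; apply/smooth_funP => p; exact: smooth_near_comp.
Qed.

Lemma comp_field (Z : N -> 'rV[R]_m) :
  vector_field Z -> vector_field_along F (Z \o F).
Proof.
move=> sZ u /sZ/smooth_funP su.
by apply/smooth_funP => p; exact: (smooth_near_comp sF (su (F p))).
Qed.

End fields_along_maps.

Section field_algebra.
Context {R : realType} {n m : nat} {M : manifold R n} {N : manifold R m}.
Context {F : M -> N}.
Implicit Types (V W : M -> 'rV[R]_m) (a : M -> R).

Lemma field0 : vector_field_along F (cst 0).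
Proof.
move=> u _; apply/smooth_funP => p.
apply: smooth_near_ext (smooth_near_cst p 0); near=> q.
by rewrite tder0v.
Unshelve. all: by end_near. Qed.

Lemma fieldD V W : vector_field_along F V -> vector_field_along F W ->
  vector_field_along F (fun p => V p + W p).
Proof.
move=> sV sW u su; apply/smooth_funP => p.
have := smooth_nearD ((smooth_funP _).1 (sV u su) p) ((smooth_funP _).1 (sW u su) p).
apply: smooth_near_ext; near=> q; rewrite tderDv//.
exact: (smooth_funP _).1.
Unshelve. all: by end_near. Qed.

Lemma fieldZ a V : smooth_fun a -> vector_field_along F V ->
  vector_field_along F (fun p => a p *: V p).
Proof.
move=> sa sV u su; apply/smooth_funP => p.
have := smooth_nearM ((smooth_funP _).1 sa p) ((smooth_funP _).1 (sV u su) p).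
apply: smooth_near_ext; near=> q; rewrite tderZ//.
exact: (smooth_funP _).1.
Unshelve. all: by end_near. Qed.

Lemma field_sum (I : finType) (V : I -> M -> 'rV[R]_m) :
  (forall i, vector_field_along F (V i)) ->
  vector_field_along F (fun p => \sum_i V i p).
Proof.
move=> sV.
suff H (s : seq I) : vector_field_along F (fun p => \sum_(i <- s) V i p) by exact: H.
elim: s => [|i s IH].
  rewrite (_ : (fun _ => _) = cst 0); first exact: field0.
  by apply/funext => p; rewrite big_nil.
rewrite (_ : (fun _ => _) = fun p => V i p + \sum_(j <- s) V j p).
  exact: fieldD.
by apply/funext => p; rewrite big_cons.
Qed.

Lemma smooth_fun_cst (c : R) : smooth_fun (cst c : M -> R).
Proof. by apply/smooth_funP => p; exact: smooth_near_cst. Qed.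

Lemma fieldN V : vector_field_along F V -> vector_field_along F (fun p => - V p).
Proof.
move=> sV; rewrite (_ : (fun _ => _) = fun p => (cst (-1) : M -> R) p *: V p).
  by apply: fieldZ => //; exact: smooth_fun_cst.
by apply/funext => p; rewrite scaleN1r.
Qed.

End field_algebra.

(** * Local frames *)

Section frames.
Context {R : realType} {m : nat} {N : manifold R m}.

(** [E] is the coordinate frame of the chart at [q0], multiplied by a cutoff,
    and [y] extends the coordinate functions of that chart. The last property
    says that the frame is dual to [y] near [q0]; it makes the fields [E]
    commute there. *)
Lemma exists_frame (q0 : N) : exists E : 'I_m -> N -> 'rV[R]_m,
  exists y : 'I_m -> N -> R, [/\ forall j, vector_field (E j),
    forall j, smooth_fun (y j),
    \forall q \near q0, forall v : 'rV[R]_m, v = \sum_j tder q v (y j) *: E j q &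
    \forall q \near q0, forall j k, tder q (E j q) (y k) = (j == k)%:R].
Proof.
pose c := chart_at q0; have cq : cdom c q0 := chart_at_dom q0.
have ac : atlas c := chart_at_atlas q0.
have [b [K [sb b1 cK Kc b0]]] := exists_cutoff (near_cdom cq).
pose E (j : 'I_m) (q : N) : 'rV[R]_m :=
  b q *: 'D_(delta_mx 0 j) (chart_at q \o cinv c) (c q).
have tE j q (u : N -> R) : cdom c q -> smooth_near q u ->
    tder q (E j q) u = b q * 'D_(delta_mx 0 j) (u \o cinv c) (c q).
  move=> dq su; rewrite tderZ//; congr (_ * _).
  have dq' := chart_at_dom q; have aq := chart_at_atlas q.
  rewrite -(near_eq_derive _ (near_chart_change u dq' dq)) derive_chain.
  - by rewrite /= cmapK.
  - exact: smooth_at_differentiable (smooth_transition _ _ _ _).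
  - by rewrite /= cmapK//; exact: smooth_at_differentiable su.
pose cE j := smooth_extension (smooth_near_chart j ac cq).
pose y j := s2val (cid2 (cE j)).
have sy j : smooth_fun (y j) by rewrite /y; case: cid2.
have yc : \forall q \near q0, forall j, \forall r \near q, c r 0 j = y j r.
  apply: filter_forall => j; apply: near_join.
  by rewrite /y; case: cid2.
exists E, y; split=> //.
- move=> j u su; have su' := (smooth_funP _).1 su.
  rewrite (_ : (fun _ => _) = fun q => b q *
      ('D_(delta_mx 0 j) (u \o cinv c) \o c) q).
    apply: smooth_fun_cutoff sb cK b0 _ => q /Kc dq.
    apply: smooth_near_pullback => //; apply: smooth_at_derive.
    exact/smooth_nearP.
  apply/funext => q; have [dq|ndq] := pselect (cdom c q); first exact: tE.
  have b00 : b q = 0 by apply: b0 => /Kc.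
  by rewrite /E b00 scale0r tder0v mul0r.
- apply: filterS (filterI (filterI (near_cdom cq) b1) yc).
  move=> q [[dq bq] yq] v; apply: (@tder_sep _ _ N q) => u su.
  rewrite tder_sumv// (tder_chart v ac dq su) derive_row; last first.
    exact/smooth_at_differentiable/smooth_nearP.
  apply: eq_bigr => j _; rewrite tderZ// tE// bq mul1r tder_coords//.
  by congr (_ * _); exact: tder_ext (yq j).
- apply: filterS (filterI (filterI (near_cdom cq) b1) yc).
  move=> q [[dq bq] yq] j k; rewrite tE//; last exact: (smooth_funP _).1.
  rewrite bq mul1r (near_eq_derive (g := fun x : 'rV[R]_m => x 0 k)).
    by rewrite -(derive_coord (F := id))// derive_id mxE eqxx eq_sym.
  apply: filterS (filterI (near_cinvK dq) (near_cinv dq (yq k))).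
  by move=> x [[_ xE] /= <-]; rewrite xE.
Qed.

(** A combination, with constant coefficients, of global fields that are a
    frame near [q0]. *)
Lemma extend_vector (q0 : N) (v : 'rV[R]_m) :
  exists2 W : N -> 'rV[R]_m, vector_field W & W q0 = v.
Proof.
have [E [y [sE sy Ey _]]] := exists_frame q0.
exists (fun q => \sum_j (cst (tder q0 v (y j)) : N -> R) q *: E j q).
  apply: field_sum => j; apply: fieldZ; [exact: smooth_fun_cst|exact: sE].
by rewrite /= -(nbhs_singleton Ey v).
Qed.

End frames.

(** * The Lie bracket as a commutator of derivations *)

Lemma smooth_at_derive_sym {R : realType} n (x v w : 'rV[R]_n)
    (F : 'rV[R]_n -> R) : smooth_at x F -> 'D_w ('D_v F) x = 'D_v ('D_w F) x.
Proof.
move=> sF; apply: derive_sym.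
- apply: filterS (near_smooth_at sF) => y sy.
  by split; apply: smooth_at_differentiable => //; exact: smooth_at_derive.
- exact/smooth_at_continuous/smooth_at_derive/smooth_at_derive.
- exact/smooth_at_continuous/smooth_at_derive/smooth_at_derive.
Qed.

Section lie_brackets.
Context {R : realType} {n : nat} {M : manifold R n}.

Let coefficient (Y : M -> 'rV[R]_n) (c : chart R n M) (x : 'rV[R]_n) :=
  tder (cinv c x) (Y (cinv c x)) c.

(** In the chart at [p], X(Yu) is the derivative of the components of [Y] along
    [X], applied to u, plus the second derivative of u along X and Y. The first
    parts give the bracket by definition and the second parts cancel by
    symmetry. *)
Lemma lie_bracketE (X Y : M -> 'rV[R]_n) p (u : M -> R) :
  vector_field X -> vector_field Y -> smooth_near p u ->
  tder p (lie_bracket X Y p) u =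
  tder p (X p) (fun q => tder q (Y q) u) - tder p (Y p) (fun q => tder q (X q) u).
Proof.
move=> sX sY su; pose c := chart_at p; have cp : cdom c p := chart_at_dom p.
have ac : atlas c := chart_at_atlas p.
pose U := u \o cinv c; have sU : smooth_at (c p) U by [].
have id_c v : tder p v c = v.
  by apply/rowP => i; rewrite tder_coords// tder_coord.
have cZ Z j : coefficient Z c (c p) 0 j = Z p 0 j.
  by rewrite /coefficient (cmapK cp) id_c.
have sc Z j : vector_field Z -> smooth_at (c p) (fun x => coefficient Z c x 0 j).
  move=> sZ; have sm := smooth_map_id M.
  have := field_smooth_near sm sZ (smooth_near_chart j ac cp).
  apply: smooth_at_ext; apply: filterS (near_cinv cp (near_cdom cp)) => x dx.
  by rewrite /= tder_coords.
have dc Z w : vector_field Z -> derivable (coefficient Z c) (c p) w.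
  move=> sZ; apply/derivable_mxP => i j; rewrite ord1.
  exact/diff_derivable/smooth_at_differentiable/sc.
(* the components of Z in the chart and the partial derivatives of U are both
   differentiated along w; the second derivatives are regrouped by symmetry *)
have half Z w : vector_field Z ->
    'D_w ((fun q => tder q (Z q) u) \o cinv c) (c p) =
    'D_('D_w (coefficient Z c) (c p)) U (c p) + 'D_(Z p) ('D_w U) (c p).
  move=> sZ; pose S := \sum_j (fun x => coefficient Z c x 0 j) *
      'D_(delta_mx 0 j) U.
  rewrite (near_eq_derive (g := S)); last first.
    apply: filterS (filterI (near_cinvK cp) (near_cinv cp (near_smooth_near su))).
    move=> x [[dx xE] sx]; rewrite /S fct_sumE/= (tder_chart _ ac dx sx).
    rewrite derive_row; last exact/smooth_at_differentiable/smooth_nearP.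
    by rewrite xE.
  have dZ j : derivable (fun x => coefficient Z c x 0 j) (c p) w.
    exact/diff_derivable/smooth_at_differentiable/sc.
  have dU j : derivable ('D_(delta_mx 0 j) U) (c p) w.
    exact/diff_derivable/smooth_at_differentiable/smooth_at_derive.
  rewrite derive_sum; last by move=> j; exact: derivableM.
  rewrite [in X in _ = X + _]derive_row; last exact: smooth_at_differentiable.
  rewrite [in X in _ = _ + X]derive_row; last first.
    exact/smooth_at_differentiable/smooth_at_derive.
  rewrite -big_split; apply: eq_bigr => j _ /=.
  have e1 : 'D_w ('D_(delta_mx 0 j) U) (c p) = 'D_(delta_mx 0 j) ('D_w U) (c p).
    exact: smooth_at_derive_sym.
  have e2 := derive_coord j (dc Z w sZ).
  have e3 := cZ Z j.
  have aux (a b d e a' b' e' : R) :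
      a = a' -> b = b' -> e' = e -> a *: b + d *: e = e' *: d + a' *: b'.
    by move=> -> -> ->; rewrite addrC; congr (_ + _); exact: mulrC.
  exact: (etrans (deriveM (dZ j) (dU j)) (aux _ _ _ _ _ _ _ e3 e1 e2)).
have sym : 'D_(Y p) ('D_(X p) U) (c p) = 'D_(X p) ('D_(Y p) U) (c p).
  exact: smooth_at_derive_sym.
have lin a b : tder p (a - b) u = tder p a u - tder p b u.
  by have := tder_lin (-1) b a su; rewrite scaleN1r mulN1r addrC => ->; rewrite addrC.
have eL := lin ('D_(X p) (coefficient Y c) (c p)) ('D_(Y p) (coefficient X c) (c p)).
have aux (a b d e : R) : d = e -> a - b = (a + d) - (b + e).
  by move=> ->; rewrite opprD addrACA subrr addr0.
apply: etrans eL (etrans (aux _ _ _ _ sym) _); symmetry.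
by congr (_ - _); [exact: half|exact: half].
Qed.

End lie_brackets.

(** * Connections along a map *)

Section connections.
Context {R : realType} {n m : nat} {M : manifold R n} {N : manifold R m}.
Context {F : M -> N}.
Context {D : (M -> 'rV[R]_n) -> (M -> 'rV[R]_m) -> M -> 'rV[R]_m}.
Hypothesis cD : connection_along F D.
Implicit Types (X Y : M -> 'rV[R]_n) (V W : M -> 'rV[R]_m) (a : M -> R).

Lemma conn_field X V : vector_field X -> vector_field_along F V ->
  vector_field_along F (D X V).
Proof. by case: cD => H *; exact: H. Qed.

Lemma connD X V W p : vector_field X -> vector_field_along F V ->
  vector_field_along F W ->
  D X (fun q => V q + W q) p = D X V p + D X W p.
Proof. by case: cD => _ _ H _ *; exact: H. Qed.

Lemma connZ a X V p : smooth_fun a -> vector_field X ->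
  vector_field_along F V ->
  D X (fun q => a q *: V q) p = tder p (X p) a *: V p + a p *: D X V p.
Proof. by case: cD => _ _ _ H *; exact: H. Qed.

Lemma conn0 X p : vector_field X -> D X (cst 0) p = 0.
Proof.
move=> sX; have s0 : smooth_fun (cst 0 : M -> R) by exact: smooth_fun_cst.
have := connZ p s0 sX field0; rewrite tder_cst !scale0r addr0.
by rewrite (_ : (fun _ => _) = cst 0)//; apply/funext => q; rewrite scale0r.
Qed.

Lemma connN X V p : vector_field X -> vector_field_along F V ->
  D X (fun q => - V q) p = - D X V p.
Proof.
move=> sX sV; have s1 : smooth_fun (cst (-1) : M -> R) by exact: smooth_fun_cst.
have := connZ p s1 sX sV; rewrite tder_cst scale0r add0r scaleN1r => <-.
by congr (D X _ p); apply/funext => q; rewrite scaleN1r.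
Qed.

Lemma conn_sum (I : finType) X (V : I -> M -> 'rV[R]_m) p : vector_field X ->
  (forall i, vector_field_along F (V i)) ->
  D X (fun q => \sum_i V i q) p = \sum_i D X (V i) p.
Proof.
move=> sX sV.
suff H (s : seq I) : vector_field_along F (fun q => \sum_(i <- s) V i q) /\
    D X (fun q => \sum_(i <- s) V i q) p = \sum_(i <- s) D X (V i) p.
  by have [] := H (index_enum I).
elim: s => [|i s [sS IH]].
  rewrite (_ : (fun _ => _) = cst 0); last first.
    by apply/funext => q; rewrite big_nil.
  by rewrite big_nil conn0//; split=> //; exact: field0.
rewrite (_ : (fun _ => _) = fun q => V i q + \sum_(j <- s) V j q); last first.
  by apply/funext => q; rewrite big_cons.
split; first exact: fieldD (sV i) sS.
by rewrite big_cons -IH; exact: connD sX (sV i) sS.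
Qed.

(** A connection sees only the germ of the section: if b is a cutoff with b = 1
    near p and b (V - W) = 0, the Leibniz rule reads 0 = D_X (V - W) at p. *)
Lemma conn_local X V W p : vector_field X -> vector_field_along F V ->
  vector_field_along F W -> (\near p, V p = W p) -> D X V p = D X W p.
Proof.
move=> sX sV sW VW; have sN := fieldN sW; have sU := fieldD sV sN.
have [b [K [sb b1 _ KO b0]]] := exists_cutoff VW.
have := connZ p sb sX sU.
rewrite (_ : (fun _ => _) = cst 0); last first.
  (* V and W agree on the support K of the cutoff *)
  apply/funext => q; have [/KO ->|nK] := pselect (K q).
    by rewrite subrr scaler0.
  by rewrite b0// scale0r.
rewrite conn0// (nbhs_singleton VW) subrr scaler0 add0r (nbhs_singleton b1).
rewrite scale1r connD// connN// => /esym/eqP.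
by rewrite subr_eq0 => /eqP.
Qed.

Lemma conn_lin a X Y V p : smooth_fun a -> vector_field X -> vector_field Y ->
  vector_field_along F V ->
  D (fun q => a q *: X q + Y q) V p = a p *: D X V p + D Y V p.
Proof. by case: cD => _ H _ _ *; exact: H. Qed.

Lemma conn0X V p : vector_field_along F V -> D (cst 0) V p = 0.
Proof.
move=> sV; have s0 : vector_field (cst 0 : M -> 'rV[R]_n) by exact: field0.
have s1 : smooth_fun (cst (-1) : M -> R) by exact: smooth_fun_cst.
have := conn_lin p s1 s0 s0 sV; rewrite scaleN1r addNr => <-.
by congr (D _ V p); apply/funext => q; rewrite scaler0 addr0.
Qed.

Lemma conn_sumX (I : finType) (X : I -> M -> 'rV[R]_n) (c : I -> R) V p :
  (forall i, vector_field (X i)) -> vector_field_along F V ->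
  D (fun q => \sum_i c i *: X i q) V p = \sum_i c i *: D (X i) V p.
Proof.
move=> sX sV.
suff H (s : seq I) : vector_field (fun q => \sum_(i <- s) c i *: X i q) /\
    D (fun q => \sum_(i <- s) c i *: X i q) V p = \sum_(i <- s) c i *: D (X i) V p.
  by have [] := H (index_enum I).
elim: s => [|i s [sS IH]].
  rewrite (_ : (fun _ => _) = cst 0); last first.
    by apply/funext => q; rewrite big_nil.
  by rewrite big_nil conn0X//; split=> //; exact: field0.
rewrite (_ : (fun _ => _) =
    fun q => (cst (c i) : M -> R) q *: X i q + \sum_(j <- s) c j *: X j q); last first.
  by apply/funext => q; rewrite big_cons.
have sc : smooth_fun (cst (c i) : M -> R) by exact: smooth_fun_cst.
split; first exact: fieldD (fieldZ sc (sX i)) sS.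
by rewrite big_cons -IH; exact: conn_lin sc (sX i) sS sV.
Qed.

End connections.

(** * Curvature of a connection along a map *)

Section curvature_along.
Context {R : realType} {n m : nat} {M : manifold R n} {N : manifold R m}.
Context {F : M -> N}.
Context {D : (M -> 'rV[R]_n) -> (M -> 'rV[R]_m) -> M -> 'rV[R]_m}.

Definition curvature_along (X Y : M -> 'rV[R]_n) (V : M -> 'rV[R]_m) :
    M -> 'rV[R]_m :=
  fun p => D X (D Y V) p - D Y (D X V) p - D (lie_bracket X Y) V p.

(** Smoothness of the bracket is read off its action on functions. *)
Lemma lie_field (X Y : M -> 'rV[R]_n) :
  vector_field X -> vector_field Y -> vector_field (lie_bracket X Y).
Proof.
move=> sX sY u su; have sp p := (smooth_funP _).1 su p.
rewrite (_ : (fun _ => _) = fun p => tder p (X p) (fun q => tder q (Y q) u) +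
    (cst (-1) : M -> R) p * tder p (Y p) (fun q => tder q (X q) u)).
  apply/smooth_funP => p; apply: smooth_nearD; last apply: smooth_nearM.
  - exact: (smooth_funP _).1 (sX _ (sY _ su)) p.
  - exact: smooth_near_cst.
  - exact: (smooth_funP _).1 (sY _ (sX _ su)) p.
by apply/funext => p; rewrite lie_bracketE//= mulN1r.
Qed.

Hypothesis cD : connection_along F D.
Variables X Y : M -> 'rV[R]_n.
Hypothesis sX : vector_field X.
Hypothesis sY : vector_field Y.
Implicit Types (V W : M -> 'rV[R]_m) (a : M -> R).

Let sXY : vector_field (lie_bracket X Y). Proof. exact: lie_field. Qed.

Lemma curvature_along_local V W p : vector_field_along F V ->
  vector_field_along F W -> (\near p, V p = W p) ->
  curvature_along X Y V p = curvature_along X Y W p.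
Proof.
move=> sV sW VW; rewrite /curvature_along.
have VW' Z : vector_field Z -> \near p, D Z V p = D Z W p.
  by move=> sZ; apply: filterS (near_join VW) => q; exact: (conn_local cD).
have sD Z U : vector_field Z -> vector_field_along F U ->
  vector_field_along F (D Z U) by exact: (conn_field cD).
rewrite (conn_local cD sX (sD _ _ sY sV) (sD _ _ sY sW) (VW' _ sY)).
rewrite (conn_local cD sY (sD _ _ sX sV) (sD _ _ sX sW) (VW' _ sX)).
by rewrite (conn_local cD sXY sV sW VW).
Qed.

Lemma curvature_along_sum (I : finType) (V : I -> M -> 'rV[R]_m) p :
  (forall i, vector_field_along F (V i)) ->
  curvature_along X Y (fun q => \sum_i V i q) p =
  \sum_i curvature_along X Y (V i) p.
Proof.
move=> sV; rewrite /curvature_along.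
have sD Z i : vector_field Z -> vector_field_along F (D Z (V i)).
  by move=> sZ; exact: (conn_field cD).
have E Z : vector_field Z -> D Z (fun q => \sum_i V i q) = fun q => \sum_i D Z (V i) q.
  by move=> sZ; apply/funext => q; rewrite (conn_sum cD).
rewrite (E Y sY) (E X sX) (conn_sum cD p sXY sV).
rewrite (conn_sum cD p sX (fun i => sD Y i sY)).
by rewrite (conn_sum cD p sY (fun i => sD X i sX)) !sumrB.
Qed.

(** The terms in which derivatives of [a] multiply derivatives of [V] are
    symmetric in X and Y, and the second derivatives of [a] combine to X(Ya) -
    Y(Xa) - [X, Y]a = 0. *)
Lemma curvature_alongZ a V p : smooth_fun a -> vector_field_along F V ->
  curvature_along X Y (fun q => a q *: V q) p = a p *: curvature_along X Y V p.
Proof.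
move=> sa sV; have sap := (smooth_funP _).1 sa p; rewrite /curvature_along.
have sD Z : vector_field Z -> vector_field_along F (D Z V).
  by move=> sZ; exact: (conn_field cD).
have E Z Z' : vector_field Z -> vector_field Z' ->
    D Z' (D Z (fun q => a q *: V q)) p =
    tder p (Z' p) (fun q => tder q (Z q) a) *: V p + tder p (Z p) a *: D Z' V p +
    (tder p (Z' p) a *: D Z V p + a p *: D Z' (D Z V) p).
  move=> sZ sZ'.
  rewrite (_ : D Z (fun q => a q *: V q) =
      fun q => tder q (Z q) a *: V q + a q *: D Z V q); last first.
    by apply/funext => q; rewrite (connZ cD).
  have sZa : smooth_fun (fun q => tder q (Z q) a) by exact: sZ.
  rewrite (connD cD p sZ' (fieldZ sZa sV) (fieldZ sa (sD Z sZ))).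
  by rewrite (connZ cD p sZa sZ' sV) (connZ cD p sa sZ' (sD Z sZ)).
rewrite (E Y X sY sX) (E X Y sX sY) (connZ cD p sa sXY sV) (lie_bracketE sX sY sap).
move: (tder p (X p) _) (tder p (Y p) _) (tder p (X p) a) (tder p (Y p) a) => s t s' t'.
move: (D X (D Y V) p) (D Y (D X V) p) (D (lie_bracket X Y) V p) (D X V p) (D Y V p) (V p).
move=> A B C E1 E2 v; apply/rowP => i; rewrite !mxE; ring.
Qed.

End curvature_along.

(** * Symmetric tensors *)

Section metrics.
Context {R : realType} {n : nat} {M : manifold R n}.
Context {g : M -> 'rV[R]_n -> 'rV[R]_n -> R}.
Hypothesis sg : symmetric_tensor g.

Lemma metricC p u v : g p u v = g p v u.
Proof. by case: sg. Qed.

Lemma metric_lin p a u v w : g p (a *: u + v) w = a * g p u w + g p v w.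
Proof. by case: sg. Qed.

Lemma metric0 p w : g p 0 w = 0.
Proof. by have := metric_lin p (-1) 0 0 w; rewrite scaler0 addr0 mulN1r addNr. Qed.

Lemma metricZ p a u w : g p (a *: u) w = a * g p u w.
Proof. by have := metric_lin p a u 0 w; rewrite addr0 metric0 addr0. Qed.

Lemma metricD p u v w : g p (u + v) w = g p u w + g p v w.
Proof. by have := metric_lin p 1 u v w; rewrite scale1r mul1r. Qed.

Lemma metricB p u v w : g p (u - v) w = g p u w - g p v w.
Proof. by rewrite -scaleN1r metricD metricZ mulN1r. Qed.

Lemma metric_sum p (I : finType) (v : I -> 'rV[R]_n) w :
  g p (\sum_i v i) w = \sum_i g p (v i) w.
Proof.
elim/big_rec2: _ => [|i a b _ <-]; first exact: metric0.
exact: metricD.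
Qed.

Lemma metric_comb p K a b u v w :
  g p (K *: (a *: u - b *: v)) w = K * (a * g p u w - b * g p v w).
Proof. by rewrite metricZ metricB !metricZ. Qed.

End metrics.

(** * Curvature of a pull-back connection *)

(** Expansion of a curvature-like expression in a frame: [a] and [b] are the
    components of two vectors, [c] those of a linear form, and [H k j] stands
    for the second covariant derivative along the k-th and the j-th members of
    the frame. *)
Lemma antisymmetric_frame_sum (R : comPzRingType) (V : lmodType R) (I : finType)
    (a b c : I -> R) (e : I -> V) (H : I -> I -> V) (K : R) :
  (forall j k, H k j - H j k = K *: (c j *: e k - c k *: e j)) ->
  \sum_j \sum_k (a j * b k) *: H k j - \sum_j \sum_k (b j * a k) *: H k j =
  K *: ((\sum_j a j * c j) *: (\sum_k b k *: e k) -
        (\sum_k b k * c k) *: (\sum_j a j *: e j)).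
Proof.
move=> HE.
rewrite [X in _ - X = _]exchange_big -sumrB.
have -> : (\sum_j a j * c j) *: (\sum_k b k *: e k) =
    \sum_j \sum_k (a j * c j) *: (b k *: e k).
  by rewrite scaler_suml; apply: eq_bigr => j _; rewrite scaler_sumr.
have -> : (\sum_k b k * c k) *: (\sum_j a j *: e j) =
    \sum_j \sum_k (b k * c k) *: (a j *: e j).
  rewrite scaler_suml exchange_big; apply: eq_bigr => k _.
  by rewrite scaler_sumr.
rewrite -sumrB scaler_sumr; apply: eq_bigr => j _.
rewrite -!sumrB scaler_sumr; apply: eq_bigr => k _.
rewrite [b k * a j]mulrC -scalerBr HE.
rewrite [LHS]scalerA [X in X *: _ = _]mulrC -[LHS]scalerA.
rewrite scalerBr !scalerA; congr (K *: (_ *: _ - _ *: _)); first exact: mulrAC.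
by rewrite [RHS]mulrC mulrA.
Qed.

(** The j-th component of [V] in a frame dual to [y]. *)
Definition frame_coord {R : realType} {n m} {M : manifold R n} {N : manifold R m}
    (F : M -> N) (y : 'I_m -> N -> R) (V : M -> 'rV[R]_m) (j : 'I_m) (q : M) : R :=
  tder (F q) (V q) (y j).

Section pullback_curvature.
Context {R : realType} {n m : nat} {M : manifold R n} {N : manifold R m}.
Context {F : M -> N}.
Context {nablaN : (N -> 'rV[R]_m) -> (N -> 'rV[R]_m) -> N -> 'rV[R]_m}.
Context {D : (M -> 'rV[R]_n) -> (M -> 'rV[R]_m) -> M -> 'rV[R]_m}.
Hypothesis sF : smooth_map F.
Hypothesis cN : affine_connection nablaN.
Hypothesis pb : pullback_connection F nablaN D.

Let cD : connection_along F D := pb.1.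

(** A value of nabla_W Z depends only on W at that point. For points in the
    image of [F] this is part of the description of the pull-back: both W and
    the zero field represent the push-forward of the zero field of [M]. *)
Lemma nabla_vanish W Z p : vector_field W -> vector_field Z ->
  W (F p) = 0 -> nablaN W Z (F p) = 0.
Proof.
move=> sW sZ W0; have s0 : vector_field (cst 0 : M -> 'rV[R]_n) by exact: field0.
rewrite -(pb.2 (cst 0) W Z s0 sW sZ); first exact: (conn0X cD p (comp_field sF sZ)).
by rewrite W0 /tangent_map tder0v.
Qed.

Variable p : M.
Variables (E : 'I_m -> N -> 'rV[R]_m) (y : 'I_m -> N -> R).
Hypothesis sE : forall j, vector_field (E j).
Hypothesis sy : forall j, smooth_fun (y j).
Hypothesis Ey : \forall q \near F p,
  forall v : 'rV[R]_m, v = \sum_j tder q v (y j) *: E j q.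
Hypothesis yE : \forall q \near F p, forall j k, tder q (E j q) (y k) = (j == k)%:R.

Local Notation comp := (frame_coord F y).

Lemma frame_coord_push X j q : comp (push F X) j q = tder q (X q) (y j \o F).
Proof. by rewrite tder_comp//; exact: (smooth_funP _).1. Qed.

Lemma near_frame : \forall q \near p,
  forall v : 'rV[R]_m, v = \sum_j tder (F q) v (y j) *: E j (F q).
Proof. exact: (smooth_map_continuous sF Ey). Qed.

(** At each point q, the field with constant coefficients equal to the
    components of f_*Y at q represents f_*Y there. *)
Lemma pullback_frame Y Z : vector_field Y -> vector_field Z ->
  \forall q \near p, D Y (Z \o F) q =
    \sum_j comp (push F Y) j q *: nablaN (E j) Z (F q).
Proof.
move=> sY sZ; apply: filterS near_frame => q Eq.
pose W r := \sum_j comp (push F Y) j q *: E j r.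
have sW : vector_field W.
  apply: field_sum => j.
  exact: (fieldZ (smooth_fun_cst (comp (push F Y) j q)) (sE j)).
rewrite (pb.2 Y W Z sY sW sZ); last by rewrite /W -Eq.
exact: (conn_sumX cN _ (F q) sE sZ).
Qed.

Lemma comp_smooth Y j : vector_field Y -> smooth_fun (comp (push F Y) j).
Proof. by move=> sY; exact: (push_field sF sY). Qed.

(** Differentiating [pullback_frame]: the derivatives of the components of
    f_*Y, then the second covariant derivatives in the frame. *)
Lemma pullback_second X Y Z : vector_field X -> vector_field Y ->
  vector_field Z -> D X (D Y (Z \o F)) p =
  \sum_j tder p (X p) (comp (push F Y) j) *: nablaN (E j) Z (F p) +
  \sum_j \sum_k (comp (push F Y) j p * comp (push F X) k p) *:
    nablaN (E k) (nablaN (E j) Z) (F p).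
Proof.
move=> sX sY sZ; have sG j : vector_field (nablaN (E j) Z) by exact: (conn_field cN).
have sGF j := comp_field sF (sG j).
have sc j := comp_smooth j sY.
pose V q := \sum_j comp (push F Y) j q *: (nablaN (E j) Z \o F) q.
have sV : vector_field_along F V.
  by apply: field_sum => j; exact: fieldZ (sc j) (sGF j).
rewrite (conn_local cD sX (conn_field cD sY (comp_field sF sZ)) sV); last first.
  exact: pullback_frame.
rewrite (conn_sum cD p sX (fun j => fieldZ (sc j) (sGF j))) -big_split.
apply: eq_bigr => j _ /=; rewrite (connZ cD p (sc j) sX (sGF j)).
rewrite (nbhs_singleton (pullback_frame sX (sG j))) scaler_sumr.
by congr (_ + _); apply: eq_bigr => k _; rewrite scalerA.
Qed.

(** Its components are derivatives of the functions E_j(y_l), which are locally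
    constant. *)
Lemma frame_bracket j k : lie_bracket (E j) (E k) (F p) = 0.
Proof.
rewrite (nbhs_singleton Ey (lie_bracket (E j) (E k) (F p))).
apply: big1 => l _; have syl := (smooth_funP _).1 (sy l) (F p).
have c0 i h : tder (F p) (E i (F p)) (fun q => tder q (E h q) (y l)) = 0.
  rewrite -(tder_cst (F p) (E i (F p)) (h == l)%:R); apply: tder_ext.
  by apply: filterS yE => q; exact.
by rewrite (lie_bracketE (sE j) (sE k) syl) !c0 subrr scale0r.
Qed.

(** In the antisymmetrized second derivatives, the derivatives of the
    components of f_*X and f_*Y are the components of f_*[X, Y] and cancel
    against the third term of the curvature; what remains is the curvature of
    [N] on the commuting frame [E]. *)
Lemma pullback_curvature_field (gN : N -> 'rV[R]_m -> 'rV[R]_m -> R) (K : R) X Y Z :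
  symmetric_tensor gN -> constant_curvature nablaN gN K ->
  vector_field X -> vector_field Y -> vector_field Z ->
  curvature_along (D := D) X Y (Z \o F) p =
  K *: (gN (F p) (push F Y p) (Z (F p)) *: push F X p -
        gN (F p) (push F X p) (Z (F p)) *: push F Y p).
Proof.
move=> sg cK sX sY sZ.
have cancel_aux (a b a' b' : 'rV[R]_m) : a + b - (a' + b') - (a - a') = b - b'.
  by rewrite opprD addrACA [a - a' + _]addrC addrK.
have sXY := lie_field sX sY.
have lc j : comp (push F (lie_bracket X Y)) j p =
    tder p (X p) (comp (push F Y) j) - tder p (Y p) (comp (push F X) j).
  have syj q := (smooth_funP _).1 (sy j) (F q).
  have sc := smooth_near_comp sF (syj p).
  have eX : tder p (X p) (comp (push F Y) j) =
      tder p (X p) (fun q => tder q (Y q) (y j \o F)).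
    by apply: tder_ext; apply: filterE => q; exact: frame_coord_push.
  have eY : tder p (Y p) (comp (push F X) j) =
      tder p (Y p) (fun q => tder q (X q) (y j \o F)).
    by apply: tder_ext; apply: filterE => q; exact: frame_coord_push.
  apply: etrans (frame_coord_push _ _ _) _.
  exact: (etrans (lie_bracketE sX sY sc)
    (esym (congr2 (fun s t : R => s - t) eX eY))).
have EX := nbhs_singleton near_frame (push F X p).
have EY := nbhs_singleton near_frame (push F Y p).
have curvE j k : nablaN (E k) (nablaN (E j) Z) (F p) -
    nablaN (E j) (nablaN (E k) Z) (F p) =
    K *: (gN (F p) (E j (F p)) (Z (F p)) *: E k (F p) -
          gN (F p) (E k (F p)) (Z (F p)) *: E j (F p)).
  have := cK _ _ _ (sE k) (sE j) sZ (F p); rewrite /curvature => <-.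
  rewrite (nabla_vanish (lie_field (sE k) (sE j)) sZ) ?subr0//.
  exact: frame_bracket.
rewrite /curvature_along (pullback_second sX sY sZ) (pullback_second sY sX sZ).
rewrite (nbhs_singleton (pullback_frame sXY sZ)).
under [X in _ - X]eq_bigr do rewrite lc scalerBl.
rewrite sumrB.
rewrite cancel_aux.
pose a j := comp (push F Y) j p; pose b k := comp (push F X) k p.
pose gz j := gN (F p) (E j (F p)) (Z (F p)).
have gY : gN (F p) (push F Y p) (Z (F p)) = \sum_j a j * gz j.
  by rewrite {1}EY (metric_sum sg); apply: eq_bigr => j _; rewrite (metricZ sg).
have gX : gN (F p) (push F X p) (Z (F p)) = \sum_j b j * gz j.
  by rewrite {1}EX (metric_sum sg); apply: eq_bigr => j _; rewrite (metricZ sg).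
rewrite gX gY {1}EX {1}EY.
exact: (@antisymmetric_frame_sum R _ _ a b gz _
  (fun k j => nablaN (E k) (nablaN (E j) Z) (F p)) K curvE).
Qed.

End pullback_curvature.

Lemma scaled_pair_sum (R : comPzRingType) (V : lmodType R) (I : finType)
    (a b c : I -> R) (K : R) (x y : V) :
  \sum_j a j *: (K *: (b j *: x - c j *: y)) =
  K *: ((\sum_j a j * b j) *: x - (\sum_j a j * c j) *: y).
Proof.
rewrite !scaler_suml -sumrB scaler_sumr; apply: eq_bigr => j _.
by rewrite -!(scalerA (a j)) -scalerBr [LHS]scalerA mulrC -scalerA.
Qed.

Section fields_in_frames.
Context {R : realType} {n m : nat} {M : manifold R n} {N : manifold R m}.
Context {F : M -> N}.
Hypothesis sF : smooth_map F.

Lemma field_in_frame (V : M -> 'rV[R]_m) (p : M) : vector_field_along F V ->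
  exists E : 'I_m -> N -> 'rV[R]_m, exists a : 'I_m -> M -> R,
    [/\ forall j, vector_field (E j), forall j, smooth_fun (a j) &
        \near p, V p = \sum_j a j p *: E j (F p)].
Proof.
move=> sV; have [E [y [sE sy Ey _]]] := exists_frame (F p).
exists E, (frame_coord F y V); split=> // [j|]; first exact: sV (sy j).
by apply: filterS (near_frame sF Ey) => q; exact.
Qed.

(** Both sides are local and linear over functions in [V], so the formula
    passes from the fields E_j o F to all fields along [F]. *)
Lemma pullback_curvature
    (nablaN : (N -> 'rV[R]_m) -> (N -> 'rV[R]_m) -> N -> 'rV[R]_m)
    (D : (M -> 'rV[R]_n) -> (M -> 'rV[R]_m) -> M -> 'rV[R]_m)
    (gN : N -> 'rV[R]_m -> 'rV[R]_m -> R) (K : R) X Y V p :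
  affine_connection nablaN -> pullback_connection F nablaN D ->
  symmetric_tensor gN -> constant_curvature nablaN gN K ->
  vector_field X -> vector_field Y -> vector_field_along F V ->
  curvature_along (D := D) X Y V p =
  K *: (gN (F p) (push F Y p) (V p) *: push F X p -
        gN (F p) (push F X p) (V p) *: push F Y p).
Proof.
move=> cN pb sg cK sX sY sV; have cD := pb.1.
have [E [a [sE sa Va]]] := field_in_frame p sV.
have sEF j := comp_field sF (sE j).
have saE j : vector_field_along F (fun q => a j q *: (E j \o F) q).
  exact: fieldZ (sa j) (sEF j).
rewrite (curvature_along_local cD sX sY sV (field_sum saE) Va).
rewrite (curvature_along_sum cD sX sY p saE).
have [E' [y [sE' sy Ey yE]]] := exists_frame (F p).
have -> : \sum_j curvature_along (D := D) X Y (fun q => a j q *: (E j \o F) q) p =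
    \sum_j a j p *: (K *: (gN (F p) (push F Y p) (E j (F p)) *: push F X p -
        gN (F p) (push F X p) (E j (F p)) *: push F Y p)).
  apply: eq_bigr => j _.
  rewrite (curvature_alongZ cD sX sY p (sa j) (sEF j)); congr (_ *: _).
  exact: (pullback_curvature_field sF cN pb sE' sy Ey yE sg cK sX sY (sE j)).
have gV w : gN (F p) w (V p) = \sum_j a j p * gN (F p) w (E j (F p)).
  rewrite (metricC sg) (nbhs_singleton Va) (metric_sum sg).
  by apply: eq_bigr => j _; rewrite (metricZ sg) (metricC sg).
apply: etrans (@scaled_pair_sum R _ _ (fun j => a j p) _ _ K _ _) _.
by congr (K *: (_ *: _ - _ *: _)); symmetry; exact: gV.
Qed.

(** Linearity of the product rule in its first argument: it extends from
    restrictions of fields of [N] to all fields along [F]. Smoothness of the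
    function gN(V, W) is carried along, since the Leibniz rule for [tder]
    requires it. *)
Lemma metric_along_half (gN : N -> 'rV[R]_m -> 'rV[R]_m -> R)
    (D Ds : (M -> 'rV[R]_n) -> (M -> 'rV[R]_m) -> M -> 'rV[R]_m)
    X V W p :
  symmetric_tensor gN -> connection_along F D -> 
  vector_field X -> vector_field_along F V -> 
  (forall Z, vector_field Z ->
    smooth_near p (fun q => gN (F q) (Z (F q)) (W q)) /\
    tder p (X p) (fun q => gN (F q) (Z (F q)) (W q)) =
    gN (F p) (D X (Z \o F) p) (W p) + gN (F p) (Z (F p)) (Ds X W p)) ->
  smooth_near p (fun q => gN (F q) (V q) (W q)) /\
  tder p (X p) (fun q => gN (F q) (V q) (W q)) =
  gN (F p) (D X V p) (W p) + gN (F p) (V p) (Ds X W p).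
Proof.
move=> sg cD sX sV HW; have [E [a [sE sa Va]]] := field_in_frame p sV.
have sEF j := comp_field sF (sE j).
have saE j : vector_field_along F (fun q => a j q *: (E j \o F) q).
  exact: fieldZ (sa j) (sEF j).
have sap j := (smooth_funP _).1 (sa j) p.
pose G j q := gN (F q) (E j (F q)) (W q).
have sG j : smooth_near p (G j) by have [] := HW _ (sE j).
have gV : \forall q \near p, \sum_j a j q * G j q = gN (F q) (V q) (W q).
  apply: filterS Va => q ->; rewrite (metric_sum sg).
  by apply: eq_bigr => j _; rewrite (metricZ sg).
have [sS dS] : smooth_near p (fun q => \sum_j a j q * G j q) /\
    tder p (X p) (fun q => \sum_j a j q * G j q) =
    \sum_j (tder p (X p) (a j) * G j p + a j p * tder p (X p) (G j)).
  suff H (s : seq 'I_m) : smooth_near p (fun q => \sum_(j <- s) a j q * G j q) /\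
    tder p (X p) (fun q => \sum_(j <- s) a j q * G j q) =
    \sum_(j <- s) (tder p (X p) (a j) * G j p + a j p * tder p (X p) (G j)).
    exact: H.
  elim: s => [|j s [sS IH]].
    rewrite (_ : (fun _ => _) = cst 0); last first.
      by apply/funext => q; rewrite big_nil.
    by rewrite big_nil tder_cst; split=> //; exact: smooth_near_cst.
  rewrite (_ : (fun _ => _) = fun q => a j q * G j q + \sum_(j <- s) a j q * G j q);
    last by apply/funext => q; rewrite big_cons.
  have sM := smooth_nearM (sap j) (sG j).
  split; first exact: smooth_nearD sM sS.
  by rewrite big_cons -IH -(tderM (X p) (sap j) (sG j)); exact: tderD sM sS.
split; first exact: smooth_near_ext gV sS.
rewrite -(tder_ext (X p) gV) dS.
rewrite (conn_local cD sX sV (field_sum saE) Va) (conn_sum cD p sX saE).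
rewrite [in X in _ = _ + X](nbhs_singleton Va) !(metric_sum sg) -big_split.
apply: eq_bigr => j _ /=; have [_ HE] := HW _ (sE j).
rewrite (connZ cD p (sa j) sX (sEF j)) (metricD sg) !(metricZ sg) /G HE.
by rewrite mulrDr addrA.
Qed.

(** [metric_along_half] is used once in each argument; by symmetry of the
    metric the second use exchanges the roles of the two connections. On
    restrictions of two fields of [N] the identity is the duality on [N], along
    a field that extends f_*X at the point. *)
Lemma pullback_dual (gN : N -> 'rV[R]_m -> 'rV[R]_m -> R)
    (nablaN nablaNs : (N -> 'rV[R]_m) -> (N -> 'rV[R]_m) -> N -> 'rV[R]_m)
    (D Ds : (M -> 'rV[R]_n) -> (M -> 'rV[R]_m) -> M -> 'rV[R]_m)
    X V W p :
  symmetric_tensor gN -> dual_connection gN nablaN nablaNs ->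
  pullback_connection F nablaN D -> pullback_connection F nablaNs Ds ->
  vector_field X -> vector_field_along F V -> vector_field_along F W ->
  tder p (X p) (fun q => gN (F q) (V q) (W q)) =
  gN (F p) (D X V p) (W p) + gN (F p) (V p) (Ds X W p).
Proof.
move=> sg dN pb pbs sX sV sW.
suff [] : smooth_near p (fun q => gN (F q) (V q) (W q)) /\
  tder p (X p) (fun q => gN (F q) (V q) (W q)) =
  gN (F p) (D X V p) (W p) + gN (F p) (V p) (Ds X W p) by [].
apply: (metric_along_half sg pb.1 sX sV) => Z sZ.
have swap : (fun q => gN (F q) (Z (F q)) (W q)) = fun q => gN (F q) (W q) ((Z \o F) q).
  by apply/funext => q; rewrite (metricC sg).
rewrite swap addrC (metricC sg (F p) (Z _)) (metricC sg _ (D X _ p)).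
apply: (metric_along_half sg pbs.1 sX sW) => Z' sZ'.
have sgZ : smooth_fun (fun q : N => gN q (Z' q) (Z q)).
  by case: sg => _ _; exact.
have sgp := (smooth_funP _).1 sgZ (F p).
split; first exact: (smooth_near_comp sF sgp).
have [T sT TX] := extend_vector (F p) (tangent_map F p (X p)).
rewrite (pbs.2 X T Z' sX sT sZ' p TX) (pb.2 X T Z sX sT sZ p TX).
rewrite [LHS](tder_comp sF (X p) sgp) -TX.
have := dN.2 T Z Z' sT sZ sZ' (F p).
rewrite (metricC sg _ _ (nablaNs _ _ _)) (metricC sg _ (Z' (F p))) addrC => <-.
by congr (tder _ _ _); apply/funext => q; exact: metricC.
Qed.

End fields_in_frames.

(** * The Gauss and Weingarten equations *)

Section gauss_equation.
Context {R : realType} {n m : nat} {M : manifold R n} {N : manifold R m}.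
Context {f : M -> N} {gN : N -> 'rV[R]_m -> 'rV[R]_m -> R}.
Context {nabla : (M -> 'rV[R]_n) -> (M -> 'rV[R]_n) -> M -> 'rV[R]_n}.
Context {D : (M -> 'rV[R]_n) -> (M -> 'rV[R]_m) -> M -> 'rV[R]_m}.
Context {xi : M -> 'rV[R]_m} {g h : M -> 'rV[R]_n -> 'rV[R]_n -> R}.
Hypothesis sf : smooth_map f.
Hypothesis sg : symmetric_tensor gN.
Hypothesis cM : affine_connection nabla.
Hypothesis cD : connection_along f D.
Hypothesis isometric : forall p u v,
  g p u v = gN (f p) (tangent_map f p u) (tangent_map f p v).
Hypothesis normal : unit_normal_field gN f xi.
Hypothesis form : affine_fundamental_form nabla f xi D h.

Lemma gauss_tangential X Y p (w : 'rV[R]_n) :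
  vector_field X -> vector_field Y ->
  gN (f p) (D X (push f Y) p) (tangent_map f p w) = g p (nabla X Y p) w.
Proof.
move=> sX sY; case: form => _ -> //; case: normal => _ _ xin.
by rewrite (metricD sg) (metricZ sg) xin mulr0 addr0 isometric.
Qed.

(** Terms proportional to xi are orthogonal to the tangent space and disappear,
    except that the derivative of g(Y, Z) xi leaves the tangential part of D_X
    xi. *)
Lemma gauss_second X Y Z p (w : 'rV[R]_n) :
  vector_field X -> vector_field Y -> vector_field Z ->
  gN (f p) (D X (D Y (push f Z)) p) (tangent_map f p w) =
  g p (nabla X (nabla Y Z) p) w +
  h p (Y p) (Z p) * gN (f p) (D X xi p) (tangent_map f p w).
Proof.
move=> sX sY sZ; have [[_ _ sh] gauss] := form; have [sxi _ xin] := normal.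
have sYZ : vector_field (nabla Y Z) by exact: (conn_field cM).
have sh' := sh _ _ sY sZ.
rewrite (_ : D Y (push f Z) = fun q =>
    push f (nabla Y Z) q + h q (Y q) (Z q) *: xi q); last first.
  by apply/funext => q; exact: gauss.
rewrite (connD cD p sX (push_field sf sYZ) (fieldZ sh' sxi)) (metricD sg).
rewrite (gauss_tangential p w sX sYZ) (connZ cD p sh' sX sxi) (metricD sg).
by rewrite !(metricZ sg) xin mulr0 add0r.
Qed.

(** Antisymmetrization of [gauss_second]. *)
Lemma gauss_curvature X Y Z p (w : 'rV[R]_n) : symmetric_tensor g ->
  vector_field X -> vector_field Y -> vector_field Z ->
  gN (f p) (curvature_along (D := D) X Y (push f Z) p) (tangent_map f p w) =
  g p (curvature nabla X Y Z p) w +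
  (h p (Y p) (Z p) * gN (f p) (D X xi p) (tangent_map f p w) -
   h p (X p) (Z p) * gN (f p) (D Y xi p) (tangent_map f p w)).
Proof.
move=> sgM sX sY sZ; rewrite /curvature_along /curvature.
rewrite !(metricB sg) !(metricB sgM) (gauss_second p w sX sY sZ).
rewrite (gauss_second p w sY sX sZ) (gauss_tangential p w (lie_field sX sY) sZ).
by ring.
Qed.

End gauss_equation.

Section shape_operator.
Context {R : realType} {n m : nat} {M : manifold R n} {N : manifold R m}.

(** Differentiation of gN(xi, f_*W) = 0, the second term being computed with
    the Gauss formula of the dual connection. *)
Lemma weingarten (gN : N -> 'rV[R]_m -> 'rV[R]_m -> R)
    (nablaN nablaNs : (N -> 'rV[R]_m) -> (N -> 'rV[R]_m) -> N -> 'rV[R]_m)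
    (nablas : (M -> 'rV[R]_n) -> (M -> 'rV[R]_n) -> M -> 'rV[R]_n)
    (f : M -> N) (xi : M -> 'rV[R]_m)
    (D Ds : (M -> 'rV[R]_n) -> (M -> 'rV[R]_m) -> M -> 'rV[R]_m)
    (hs : M -> 'rV[R]_n -> 'rV[R]_n -> R) X p (w : 'rV[R]_n) :
  smooth_map f -> symmetric_tensor gN -> dual_connection gN nablaN nablaNs ->
  pullback_connection f nablaN D -> pullback_connection f nablaNs Ds ->
  unit_normal_field gN f xi -> affine_fundamental_form nablas f xi Ds hs ->
  vector_field X ->
  gN (f p) (D X xi p) (tangent_map f p w) = - hs p (X p) w.
Proof.
move=> sf sg dN pb pbs [sxi xi1 xin] [_ gauss] sX.
have [W sW <-] := extend_vector p w.
have := pullback_dual sf p sg dN pb pbs sX sxi (push_field sf sW).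
rewrite (_ : (fun q => _) = cst 0); last first.
  by apply/funext => q; exact: xin.
rewrite tder_cst (gauss X W sX sW) (metricC sg _ (xi p)) (metricD sg).
rewrite (metricZ sg) xi1 mulr1 (metricC sg _ _ (xi p)) xin add0r => H.
by apply/eqP; rewrite -addr_eq0 -H.
Qed.

End shape_operator.

(** The constant is [kN + 1]: the ambient curvature plus the contribution of the
    shape operator - id. *)
Theorem theorem3 (R : realType) (n : nat) (hn : (3 <= n)%N)
  (N : manifold R n.+1)
  (nablaN nablaNs :
     (N -> 'rV[R]_n.+1) -> (N -> 'rV[R]_n.+1) -> N -> 'rV[R]_n.+1)
  (gN : N -> 'rV[R]_n.+1 -> 'rV[R]_n.+1 -> R) (kN : R)
  (N_connected : connected [set: N])
  (N_statistical : statistical_manifold nablaN gN)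
  (N_dual : dual_connection gN nablaN nablaNs)
  (N_curvature : constant_curvature nablaN gN kN)
  (M : manifold R n)
  (nabla nablas : (M -> 'rV[R]_n) -> (M -> 'rV[R]_n) -> M -> 'rV[R]_n)
  (g : M -> 'rV[R]_n -> 'rV[R]_n -> R)
  (M_connected : connected [set: M])
  (M_statistical : statistical_manifold nabla g)
  (M_dual : dual_connection g nabla nablas)
  (f : M -> N) (xi : M -> 'rV[R]_n.+1)
  (D Ds : (M -> 'rV[R]_n) -> (M -> 'rV[R]_n.+1) -> M -> 'rV[R]_n.+1)
  (D_pullback : pullback_connection f nablaN D)
  (Ds_pullback : pullback_connection f nablaNs Ds)
  (f_statistical : statistical_immersion nabla g gN f D)
  (xi_normal : unit_normal_field gN f xi)
  (h hs : M -> 'rV[R]_n -> 'rV[R]_n -> R)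
  (h_form : affine_fundamental_form nabla f xi D h)
  (hs_form : affine_fundamental_form nablas f xi Ds hs)
  (h_eq : h = g) (hs_eq : hs = g) :
  exists k : R, constant_curvature nabla g k.
Proof.
subst h hs.
have [[sgN _] _ _ _] := N_statistical.
have [[sg nondegenerate] cM _ _] := M_statistical.
have cN : affine_connection nablaN by case: N_statistical.
have [[sf _] isometric _] := f_statistical.
exists (kN + 1) => X Y Z sX sY sZ p.
apply/eqP; rewrite -subr_eq0; apply/eqP/(nondegenerate p) => w.
have gauss := gauss_curvature sf sgN cM D_pullback.1 isometric xi_normal
  h_form p w sg sX sY sZ.
rewrite (pullback_curvature sf p cN D_pullback sgN N_curvature sX sY
  (push_field sf sZ)) in gauss.
have shape T (sT : vector_field T) := weingarten p w sf sgN N_dual D_pullback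
  Ds_pullback xi_normal hs_form sT.
rewrite (shape X sX) (shape Y sY) in gauss.
rewrite (metric_comb sgN) in gauss.
rewrite /push -(isometric p (Y p) (Z p)) -(isometric p (X p) (Z p)) in gauss.
rewrite -(isometric p (X p) w) -(isometric p (Y p) w) in gauss.
rewrite (metricB sg) (metric_comb sg).
lra.
Qed.
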